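(* Let $\&$ be a continuous t-norm on $[0,1]$ and $\mathcal{Q}=([0,1],\&,1)$. Then the following conditions are equivalent: (1) $\&$ is either isomorphic to the {\L}ukasiewicz t-norm or to the product t-norm. (2) Each Yoneda complete ${\sf D}(\mathcal{Q})$-category with an isolated element is flat complete. (3) Each Yoneda complete ${\sf D}(\mathcal{Q})$-category with an isolated element is Cauchy complete. (4) Each bicomplete ${\sf D}(\mathcal{Q})$-category with an isolated element is Cauchy complete.
   Context: A continuous t-norm $\&$ on $[0,1]$ is a continuous, associative, commutative, monotone binary operation with unit $1$ (equivalently, $([0,1],\&,1)$ is a divisible quantale). Its implication is $a\rightarrow b=\bigvee\{c\in[0,1]\mid a\& c\leq b\}$. The {\L}ukasiewicz t-norm is $a\&b=\max\{a+b-1,0\}$; the product t-norm is $a\&b=a\cdot b$. Continuous t-norms $\&,\&'$ are isomorphic if there is an order isomorphism $f:[0,1]\to[0,1]$ with $f(a\&b)=f(a)\&'f(b)$ for all $a,b$. Throughout $\bigvee,\bigwedge,\wedge$ are suprema, infima and binary minimum in $[0,1]$ (with $\bigvee\emptyset=0$, $\bigwedge\emptyset=1$). A ${\sf D}(\mathcal{Q})$-category (ordered fuzzy set valued in $\mathcal{Q}$) $\mathbb{A}$ is a set $\mathbb{A}_0$ with a map $\mathbb{A}:\mathbb{A}_0\times\mathbb{A}_0\to[0,1]$ such that $\mathbb{A}(x,y)\leq\mathbb{A}(x,x)\wedge\mathbb{A}(y,y)$ and $(\mathbb{A}(y,y)\rightarrow\mathbb{A}(y,z))\&\mathbb{A}(x,y)\leq\mathbb{A}(x,z)$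 for all $x,y,z\in\mathbb{A}_0$. The type of $x$ is $\mathbb{A}(x,x)$; an element of type $0$ is called isolated. A weight $\phi$ on $\mathbb{A}$ of type $t\phi\in[0,1]$ is a map $\phi:\mathbb{A}_0\to[0,1]$ (together with the number $t\phi$) such that $\phi(x)\leq\mathbb{A}(x,x)\wedge t\phi$ and $(\mathbb{A}(y,y)\rightarrow\phi(y))\&\mathbb{A}(x,y)\leq\phi(x)$ for all $x,y$. A coweight $\psi$ on $\mathbb{A}$ of type $t\psi\in[0,1]$ is a map $\psi:\mathbb{A}_0\to[0,1]$ (together with $t\psi$) such that $\psi(x)\leq\mathbb{A}(x,x)\wedge t\psi$ and $(\mathbb{A}(x,x)\rightarrow\mathbb{A}(x,y))\&\psi(x)\leq\psi(y)$ for all $x,y$. For a weight $\phi$ and a coweight $\psi$, put $\phi\circ\psi=\bigvee_{x\in\mathbb{A}_0}(\mathbb{A}(x,x)\rightarrow\phi(x))\&\psi(x)$. A weight $\phi$ is flat if (i) for all $b\in[0,1]$, $\phi\circ(b\wedge t)=b\wedge t\phi$, where $b\wedge t$ is the coweight of type $b$ given by $x\mapsto b\wedge\mathbb{A}(x,x)$; and (ii) $\phi\circ(\psi_1\wedge\psi_2)=(\phi\circ\psi_1)\wedge(\phi\circ\psi_2)$ for all coweights $\psi_1,\psi_2$ of the same type (with $\psi_1\wedge\psi_2$ the pointwise minimum). A weight $\phi$ is Cauchy if it is a right adjoint, i.e. there is a coweight $\psi$ of type $t\phi$ with $\phi\circ\psi\geq t\phi$ and $(t\phi\rightarrow\psi(y))\&\phi(x)\leq\mathbb{A}(x,y)$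 for all $x,y\in\mathbb{A}_0$. A supremum of a weight $\phi$ is an element $s\in\mathbb{A}_0$ with $\mathbb{A}(s,s)=t\phi$ and $\mathbb{A}(s,y)=\mathbb{A}(y,y)\wedge\big(\big(\bigwedge_{x\in\mathbb{A}_0}(\phi(x)\rightarrow\mathbb{A}(x,y))\big)\& t\phi\big)$ for all $y\in\mathbb{A}_0$. $\mathbb{A}$ is flat complete (Cauchy complete) if every flat (Cauchy) weight on $\mathbb{A}$ has a supremum. A net $\{x_\lambda\}$ in $\mathbb{A}_0$ is forward Cauchy if $\bigvee_\lambda\bigwedge_{\nu\geq\mu\geq\lambda}\mathbb{A}(x_\mu,x_\nu)=\bigwedge_\lambda\bigvee_{\nu\geq\mu\geq\lambda}\mathbb{A}(x_\mu,x_\nu)$, and biCauchy if $\bigvee_\lambda\bigwedge_{\nu,\mu\geq\lambda}\mathbb{A}(x_\mu,x_\nu)=\bigwedge_\lambda\bigvee_{\nu,\mu\geq\lambda}\mathbb{A}(x_\mu,x_\nu)$. An element $x\in\mathbb{A}_0$ is a Yoneda limit of $\{x_\lambda\}$ if $\mathbb{A}(x,x)=\bigvee_\lambda\bigwedge_{\sigma\geq\lambda}\mathbb{A}(x_\sigma,x_\sigma)$ and $\mathbb{A}(x,y)=\bigvee_\lambda\bigwedge_{\sigma\geq\lambda}\mathbb{A}(x_\sigma,y)$ for all $y\in\mathbb{A}_0$; it is a bilimit of $\{x_\lambda\}$ if $\mathbb{A}(x,x)=\bigvee_\lambda\bigwedge_{\sigma\geq\lambda}\mathbb{A}(x_\sigma,x)=\bigvee_\lambda\bigwedge_{\sigma\geq\lambda}\mathbb{A}(x,x_\sigma)=\bigvee_\lambda\bigwedge_{\sigma\geq\lambda}\mathbb{A}(x_\sigma,x_\sigma)$.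 $\mathbb{A}$ is Yoneda complete if every forward Cauchy net has a Yoneda limit, and bicomplete if every biCauchy net has a bilimit. *)

(* Defs.v *)
From HB Require Import structures.
From mathcomp Require Import all_boot all_order all_algebra.
From mathcomp Require Import all_classical all_reals all_analysis.

Set Implicit Arguments.
Unset Strict Implicit.
Unset Printing Implicit Defensive.

Import Order.TTheory GRing.Theory Num.Theory.
Import numFieldNormedType.Exports.

Local Open Scope classical_set_scope.
Local Open Scope ring_scope.

(* The quantale [0,1] is represented inside R: operations on [0,1] are functions
   on R of which only the values on [0,1] are ever used. *)

(* Suprema and infima of families in [0,1]. Library convention [sup set0 = 0]
   agrees with that of [0,1]; since also [inf set0 = 0], the bound 1 is added to
   the family, so that the empty infimum is 1. *)
Definition join01 (R : realType) (I : Type) (P : set I) (F : I -> R) : R :=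
  sup [set F i | i in P].

Definition meet01 (R : realType) (I : Type) (P : set I) (F : I -> R) : R :=
  inf (1 |` [set F i | i in P]).

Record continuous_tnorm (R : realType) (tn : R -> R -> R) : Prop :=
  ContinuousTnorm {
    tnorm_01 : forall a b : R,
      0 <= a <= 1 -> 0 <= b <= 1 -> 0 <= tn a b <= 1;
    tnormA : forall a b c : R,
      0 <= a <= 1 -> 0 <= b <= 1 -> 0 <= c <= 1 ->
      tn a (tn b c) = tn (tn a b) c;
    tnormC : forall a b : R,
      0 <= a <= 1 -> 0 <= b <= 1 -> tn a b = tn b a;
    tnorm_le : forall a a' b b' : R,
      0 <= a <= 1 -> 0 <= a' <= 1 -> 0 <= b <= 1 -> 0 <= b' <= 1 ->
      a <= a' -> b <= b' -> tn a b <= tn a' b';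
    tnorm1 : forall a : R, 0 <= a <= 1 -> tn a 1 = a;
    tnorm_continuous :
      {within (`[0, 1]%classic `*` `[0, 1]%classic : set (R * R)),
        continuous (fun p : R * R => tn p.1 p.2)}
  }.

Definition timpl (R : realType) (tn : R -> R -> R) (a b : R) : R :=
  sup [set c : R | 0 <= c <= 1 /\ tn a c <= b].

Definition lukasiewicz (R : realType) (a b : R) : R := Num.max (a + b - 1) 0.

Definition product_tnorm (R : realType) (a b : R) : R := a * b.

Definition tnorm_isomorphic (R : realType) (tn tn' : R -> R -> R) : Prop :=
  exists f : R -> R,
    [/\ set_bij `[0, 1]%classic `[0, 1]%classic f,
        (forall a b : R, 0 <= a <= 1 -> 0 <= b <= 1 ->
           (f a <= f b) = (a <= b)) &
        (forall a b : R, 0 <= a <= 1 -> 0 <= b <= 1 ->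
           f (tn a b) = tn' (f a) (f b))].

Record dcat (R : realType) (tn : R -> R -> R) := DCat {
  dobj :> Type;
  dhom : dobj -> dobj -> R;
  dhom_01 : forall x y : dobj, 0 <= dhom x y <= 1;
  dhom_le : forall x y : dobj, dhom x y <= Num.min (dhom x x) (dhom y y);
  dhom_comp : forall x y z : dobj,
    tn (timpl tn (dhom y y) (dhom y z)) (dhom x y) <= dhom x z
}.

Definition is_isolated (R : realType) (tn : R -> R -> R) (A : dcat tn) (x : A)
  : Prop := dhom x x = 0.

Definition is_weight (R : realType) (tn : R -> R -> R) (A : dcat tn)
    (phi : A -> R) (t : R) : Prop :=
  [/\ 0 <= t <= 1,
      (forall x : A, 0 <= phi x <= 1),
      (forall x : A, phi x <= Num.min (dhom x x) t) &
      (forall x y : A, tn (timpl tn (dhom y y) (phi y)) (dhom x y) <= phi x)].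

Definition is_coweight (R : realType) (tn : R -> R -> R) (A : dcat tn)
    (psi : A -> R) (t : R) : Prop :=
  [/\ 0 <= t <= 1,
      (forall x : A, 0 <= psi x <= 1),
      (forall x : A, psi x <= Num.min (dhom x x) t) &
      (forall x y : A, tn (timpl tn (dhom x x) (dhom x y)) (psi x) <= psi y)].

Definition wcomp (R : realType) (tn : R -> R -> R) (A : dcat tn)
    (phi psi : A -> R) : R :=
  join01 [set: A] (fun x => tn (timpl tn (dhom x x) (phi x)) (psi x)).

Definition flat_weight (R : realType) (tn : R -> R -> R) (A : dcat tn)
    (phi : A -> R) (t : R) : Prop :=
  [/\ is_weight phi t,
      (forall b : R, 0 <= b <= 1 ->
         wcomp phi (fun x : A => Num.min b (dhom x x)) = Num.min b t) &
      (forall (psi1 psi2 : A -> R) (u : R),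
         is_coweight psi1 u -> is_coweight psi2 u ->
         wcomp phi (fun x : A => Num.min (psi1 x) (psi2 x)) =
         Num.min (wcomp phi psi1) (wcomp phi psi2))].

Definition cauchy_weight (R : realType) (tn : R -> R -> R) (A : dcat tn)
    (phi : A -> R) (t : R) : Prop :=
  is_weight phi t /\
  exists psi : A -> R,
    [/\ is_coweight psi t,
        t <= wcomp phi psi &
        (forall x y : A, tn (timpl tn t (psi y)) (phi x) <= dhom x y)].

Definition is_supremum (R : realType) (tn : R -> R -> R) (A : dcat tn)
    (phi : A -> R) (t : R) (s : A) : Prop :=
  dhom s s = t /\
  forall y : A,
    dhom s y =
    Num.min (dhom y y)
      (tn (meet01 [set: A] (fun x => timpl tn (phi x) (dhom x y))) t).

Definition flat_complete (R : realType) (tn : R -> R -> R) (A : dcat tn)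
  : Prop :=
  forall (phi : A -> R) (t : R),
    flat_weight phi t -> exists s : A, is_supremum phi t s.

Definition cauchy_complete (R : realType) (tn : R -> R -> R) (A : dcat tn)
  : Prop :=
  forall (phi : A -> R) (t : R),
    cauchy_weight phi t -> exists s : A, is_supremum phi t s.

Record directed_preorder (I : Type) (le : I -> I -> Prop) : Prop :=
  DirectedPreorder {
    directed_inhabited : inhabited I;
    directed_refl : forall i : I, le i i;
    directed_trans : forall i j k : I, le i j -> le j k -> le i k;
    directed_ub : forall i j : I, exists k : I, le i k /\ le j k
  }.

Definition forward_cauchy (R : realType) (tn : R -> R -> R) (A : dcat tn)
    (I : Type) (le : I -> I -> Prop) (x : I -> A) : Prop :=
  join01 [set: I] (fun l =>
    meet01 [set p : I * I | le l p.1 /\ le p.1 p.2]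
      (fun p => dhom (x p.1) (x p.2))) =
  meet01 [set: I] (fun l =>
    join01 [set p : I * I | le l p.1 /\ le p.1 p.2]
      (fun p => dhom (x p.1) (x p.2))).

Definition bicauchy (R : realType) (tn : R -> R -> R) (A : dcat tn)
    (I : Type) (le : I -> I -> Prop) (x : I -> A) : Prop :=
  join01 [set: I] (fun l =>
    meet01 [set p : I * I | le l p.1 /\ le l p.2]
      (fun p => dhom (x p.1) (x p.2))) =
  meet01 [set: I] (fun l =>
    join01 [set p : I * I | le l p.1 /\ le l p.2]
      (fun p => dhom (x p.1) (x p.2))).

Definition liminf01 (R : realType) (I : Type) (le : I -> I -> Prop)
    (F : I -> R) : R :=
  join01 [set: I] (fun l => meet01 [set s : I | le l s] F).

Definition yoneda_limit (R : realType) (tn : R -> R -> R) (A : dcat tn)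
    (I : Type) (le : I -> I -> Prop) (x : I -> A) (a : A) : Prop :=
  dhom a a = liminf01 le (fun s => dhom (x s) (x s)) /\
  forall y : A, dhom a y = liminf01 le (fun s => dhom (x s) y).

Definition bilimit (R : realType) (tn : R -> R -> R) (A : dcat tn)
    (I : Type) (le : I -> I -> Prop) (x : I -> A) (a : A) : Prop :=
  [/\ dhom a a = liminf01 le (fun s => dhom (x s) a),
      dhom a a = liminf01 le (fun s => dhom a (x s)) &
      dhom a a = liminf01 le (fun s => dhom (x s) (x s))].

Definition yoneda_complete (R : realType) (tn : R -> R -> R) (A : dcat tn)
  : Prop :=
  forall (I : Type) (le : I -> I -> Prop) (x : I -> A),
    directed_preorder le -> forward_cauchy le x ->
    exists a : A, yoneda_limit le x a.

Definition bicomplete (R : realType) (tn : R -> R -> R) (A : dcat tn)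
  : Prop :=
  forall (I : Type) (le : I -> I -> Prop) (x : I -> A),
    directed_preorder le -> bicauchy le x ->
    exists a : A, bilimit le x a.

(* Main.v *)
Require Import Defs.
From mathcomp Require Import all_boot all_order all_algebra.
From mathcomp Require Import all_classical all_reals all_analysis.
From mathcomp Require Import lra.

Set Implicit Arguments.
Unset Strict Implicit.
Unset Printing Implicit Defensive.

Import Order.TTheory GRing.Theory Num.Theory.
Import numFieldNormedType.Exports.

Local Open Scope classical_set_scope.
Local Open Scope ring_scope.

(** The property behind all four conditions is that the t-norm has no idempotent
strictly between 0 and 1, or equivalently that it is cancellative away from 0:
[0 < a & c <= b & c] implies [a <= b].

Cancellation passes to isomorphic t-norms and is clear for the two model t-norms
([cancellative_isomorphic]). It also follows directly from the absence of
idempotents, because then the powers of any [d < 1] decrease to 0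
([idempotent_free_cancellative]).

Suppose that the t-norm is cancellative and let [phi] be a weight of type [t] that
is flat or Cauchy.
If [t = 0], an isolated element is a supremum. If [t > 0], [phi] is reached by a
net. For flat [phi] the indices are pairs of an object [x] and a degree [r] below
[dhom x x --o phi x], and preservation of meets of coweights makes the index set
directed ([flat_le_directed]); the net is forward Cauchy. For Cauchy [phi] the
degree bounds [phi] and its left adjoint at the same time, and the net is
biCauchy. In both cases the types along the net tend to [t], cancellation turns
this into the statement that the hom-values relative to the types tend to 1, and
a Yoneda limit or a bilimit of the net is a supremum of [phi]
([yoneda_limit_supremum], [bilimit_supremum]). For every continuous t-norm a
Cauchy weight is flat, since composition with a right adjoint preserves meets
([cauchy_weight_flat]).

Conversely, an idempotent [e] strictly between 0 and 1 is a Cauchy weight of type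
[e] on the category with one object of type 1 and one isolated object, and it has
no supremum there, as no object has type [e]. That category is Yoneda complete
and bicomplete, for its hom-values are 0 and 1 and its Cauchy nets are ultimately
constant. Hence either of the last two conditions excludes such idempotents
([bool_cauchy_complete_idempotent]).

It remains to recover the isomorphism type of a continuous t-norm without
idempotents ([idempotent_free_isomorphic]). Iterated square roots of a base point
[c < 1] tend to 1, their powers are dense in the unit interval, and the order of
these dyadic powers is determined by which of them are 0. Matching dyadic powers
of two t-norms with the same pattern of zeros extends by suprema to an
isomorphism. If no product of positive elements is 0, the base 1/2 gives no zeros,
as for the product; otherwise the base 0 gives the same zeros as for the
Lukasiewicz t-norm. *)

(** * Suprema, infima and limits of nets in the unit interval *)

(** Nearly every law below has the side condition that its arguments lie in the
unit interval. *)
Create HintDb unit01.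

Local Ltac u01 := by auto with unit01.

Section UnitInterval.
Variable R : realType.
Implicit Types a b c : R.

Lemma zero_01 : 0 <= (0 : R) <= 1. Proof. by rewrite lexx ler01. Qed.

Lemma one_01 : 0 <= (1 : R) <= 1. Proof. by rewrite lexx ler01. Qed.

Lemma min_01 a b : 0 <= a <= 1 -> 0 <= b <= 1 -> 0 <= Num.min a b <= 1.
Proof. by move=> ha hb; case: (leP a b). Qed.

Lemma max_01 a b : 0 <= a <= 1 -> 0 <= b <= 1 -> 0 <= Num.max a b <= 1.
Proof. by move=> ha hb; case: (leP a b). Qed.

Lemma mid_01 a b : 0 <= a <= 1 -> 0 <= b <= 1 -> a < b ->
  exists c, [/\ 0 <= c <= 1, a < c & c < b].
Proof. by move=> ha hb ab; exists ((a + b) / 2); split; lra. Qed.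

Variable I : Type.
Implicit Types (P : set I) (F : I -> R).

Lemma join01_lub P F c : 0 <= c -> (forall i, P i -> F i <= c) ->
  join01 P F <= c.
Proof.
move=> c0 hF; rewrite /join01.
have [-> | ne] := eqVneq [set F i | i in P] set0; first by rewrite sup0.
apply: ge_sup; first exact/set0P.
by move=> _ [i Pi <-]; exact: hF.
Qed.

Lemma join01_ub P F i : (forall j, 0 <= F j <= 1) -> P i ->
  F i <= join01 P F.
Proof.
move=> hF Pi; apply: ub_le_sup; last by exists i.
by exists 1 => _ [j _ <-]; case/andP: (hF j).
Qed.

Lemma join01_01 P F : (forall j, 0 <= F j <= 1) -> 0 <= join01 P F <= 1.
Proof.
move=> hF; apply/andP; split; last first.
  by apply: join01_lub => // i _; case/andP: (hF i).
have [e|/set0P[i Pi]] := eqVneq P set0.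
  by rewrite /join01 e image_set0 sup0.
by apply: le_trans (join01_ub hF Pi); case/andP: (hF i).
Qed.

Lemma lt_join01 P F c : 0 <= c -> c < join01 P F ->
  exists2 i, P i & c < F i.
Proof.
move=> c0; apply: contraPP => nh; apply/negP; rewrite -leNgt.
apply: join01_lub => // i Pi; rewrite leNgt; apply/negP => ci.
by apply: nh; exists i.
Qed.

Lemma meet01_glb P F c : c <= 1 -> (forall i, P i -> c <= F i) ->
  c <= meet01 P F.
Proof.
move=> c1 hF; apply: lb_le_inf; first by exists 1; left.
by move=> _ [->|[i Pi <-]] //; exact: hF.
Qed.

Lemma meet01_lb P F i : (forall j, 0 <= F j <= 1) -> P i ->
  meet01 P F <= F i.
Proof.
move=> hF Pi; apply: ge_inf; last by right; exists i.
by exists 0 => _ [->|[j _ <-]] //; case/andP: (hF j).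
Qed.

Lemma meet01_01 P F : (forall j, 0 <= F j <= 1) -> 0 <= meet01 P F <= 1.
Proof.
move=> hF; apply/andP; split.
  by apply: meet01_glb => // i _; case/andP: (hF i).
apply: ge_inf; last by left.
by exists 0 => _ [->|[j _ <-]] //; case/andP: (hF j).
Qed.

End UnitInterval.

#[local] Hint Resolve zero_01 one_01 min_01 max_01 join01_01 meet01_01 : unit01.

(** Both Cauchy conditions compare a join of meets with a meet of joins over a
family [S] of index sets, one for each [l], and both notions of limit are such a
join of meets. Only [S] differs: ordered pairs of indices, all pairs, single
indices. *)
Lemma join_meet_limit (R : realType) (L J : Type) (S : L -> set J)
    (F : J -> R) (t : R) :
  inhabited L -> (forall l l', exists j, S l j /\ S l' j) ->
  (forall j, 0 <= F j <= 1) -> 0 <= t <= 1 ->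
  (forall c, 0 <= c -> c < t -> exists l, forall j, S l j -> c <= F j) ->
  (forall c, t < c -> exists l, forall j, S l j -> F j <= c) ->
  join01 [set: L] (fun l => meet01 (S l) F) = t /\
  meet01 [set: L] (fun l => join01 (S l) F) = t.
Proof.
move=> [l0] dir hF ht lower upper.
have mS l : 0 <= meet01 (S l) F <= 1 by exact: meet01_01.
have jS l : 0 <= join01 (S l) F <= 1 by exact: join01_01.
have le_jm : t <= join01 [set: L] (fun l => meet01 (S l) F).
  rewrite leNgt; apply/negP => lt_t.
  have [c [hc c1 c2]] := mid_01 (join01_01 [set: L] mS) ht lt_t.
  have [l hl] := lower c ltac:(by case/andP: hc) c2.
  suff : c <= join01 [set: L] (fun l => meet01 (S l) F).
    by rewrite leNgt c1.
  apply: le_trans (join01_ub (i := l) mS _) => //.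
  by apply: meet01_glb => //; case/andP: hc.
have le_mj : join01 [set: L] (fun l => meet01 (S l) F) <=
    meet01 [set: L] (fun l => join01 (S l) F).
  apply: meet01_glb; first by case/andP: (join01_01 [set: L] mS).
  move=> l' _; apply: join01_lub; first by case/andP: (jS l').
  move=> l _; have [j [Slj Sl'j]] := dir l l'.
  exact: le_trans (meet01_lb hF Slj) (join01_ub hF Sl'j).
have le_t : meet01 [set: L] (fun l => join01 (S l) F) <= t.
  rewrite leNgt; apply/negP => lt_t.
  have [c [hc c1 c2]] := mid_01 ht (meet01_01 [set: L] jS) lt_t.
  have [l hl] := upper c c1.
  suff : meet01 [set: L] (fun l => join01 (S l) F) <= c by rewrite leNgt c2.
  apply: le_trans (meet01_lb (i := l) jS _) _ => //.
  by apply: join01_lub => //; case/andP: hc.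
by split; apply/eqP;
   rewrite eq_le ?le_jm ?le_t ?(le_trans le_mj) ?(le_trans le_jm).
Qed.

Section Nets.
Variables (R : realType) (I : Type) (le : I -> I -> Prop).
Hypothesis dir : directed_preorder le.

Definition ultimately (Q : I -> Prop) : Prop :=
  exists l, forall s, le l s -> Q s.

Lemma ultimately_and Q Q' :
  ultimately Q -> ultimately Q' -> ultimately (fun s => Q s /\ Q' s).
Proof.
move=> [l hl] [l' hl']; have [k [lk l'k]] := directed_ub dir l l'.
exists k => s ks.
by split; [apply: hl|apply: hl']; apply: (directed_trans dir) ks.
Qed.

Lemma ultimately_ex Q : ultimately Q -> exists s, Q s.
Proof. by move=> [l hl]; exists l; apply/hl/(directed_refl dir). Qed.

Lemma liminf01_limit (F : I -> R) (t : R) :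
  (forall s, 0 <= F s <= 1) -> 0 <= t <= 1 ->
  (forall c, 0 <= c -> c < t -> ultimately (fun s => c <= F s)) ->
  (forall c, t < c -> ultimately (fun s => F s <= c)) ->
  liminf01 le F = t.
Proof.
move=> hF ht lower upper.
have [] // := @join_meet_limit R I I (fun l => [set s | le l s]) F t.
- exact: directed_inhabited dir.
- exact: directed_ub dir.
Qed.

Lemma lt_liminf01 (F : I -> R) (c : R) :
  (forall s, 0 <= F s <= 1) -> 0 <= c -> c < liminf01 le F ->
  ultimately (fun s => c <= F s).
Proof.
move=> hF c0 /(lt_join01 c0)[l _ cl]; exists l => s ls.
by apply: le_trans (ltW cl) _; apply: meet01_lb.
Qed.

Lemma ge_liminf01 (F : I -> R) (c : R) :
  (forall s, 0 <= F s <= 1) -> c <= 1 ->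
  ultimately (fun s => c <= F s) -> c <= liminf01 le F.
Proof.
move=> hF c1 [l hl].
apply: le_trans (join01_ub (i := l) (fun i => meet01_01 _ hF) _) => //.
exact: meet01_glb.
Qed.

End Nets.

(** * Residuation for a continuous t-norm *)

Section Tnorm.
Variables (R : realType) (tn : R -> R -> R).
Hypothesis tnP : continuous_tnorm tn.
Local Notation "a ** b" := (tn a b) (at level 40, left associativity).
Local Notation "a --o b" := (timpl tn a b) (at level 45, right associativity).
Implicit Types a b c d e q r s : R.

Lemma tn_01 a b : 0 <= a <= 1 -> 0 <= b <= 1 -> 0 <= a ** b <= 1.
Proof. exact: (tnorm_01 tnP). Qed.

Lemma timpl_01 a b : 0 <= a --o b <= 1.
Proof.
rewrite /timpl; set S := [set c | _].
have ubS : ubound S 1 by move=> c [/andP[]].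
have [->|/set0P[c Sc]] := eqVneq S set0; first by rewrite sup0 lexx ler01.
apply/andP; split; last by apply: ge_sup => //; exists c.
apply: (@le_trans _ _ c); first by case: Sc => /andP[].
by apply: ub_le_sup => //; exists 1.
Qed.

#[local] Hint Resolve tn_01 timpl_01 : unit01.

Lemma tnC a b : 0 <= a <= 1 -> 0 <= b <= 1 -> a ** b = b ** a.
Proof. exact: (tnormC tnP). Qed.

Lemma tnA a b c : 0 <= a <= 1 -> 0 <= b <= 1 -> 0 <= c <= 1 ->
  a ** (b ** c) = a ** b ** c.
Proof. exact: (tnormA tnP). Qed.

Lemma tnAC a b c : 0 <= a <= 1 -> 0 <= b <= 1 -> 0 <= c <= 1 ->
  a ** b ** c = a ** c ** b.
Proof. by move=> ha hb hc; rewrite -!tnA ?(@tnC b). Qed.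

Lemma tnCA a b c : 0 <= a <= 1 -> 0 <= b <= 1 -> 0 <= c <= 1 ->
  a ** (b ** c) = b ** (a ** c).
Proof. by move=> ha hb hc; rewrite !tnA ?(@tnC a). Qed.

Lemma tn_le a a' b b' : 0 <= a <= 1 -> 0 <= a' <= 1 -> 0 <= b <= 1 ->
  0 <= b' <= 1 -> a <= a' -> b <= b' -> a ** b <= a' ** b'.
Proof. exact: (tnorm_le tnP). Qed.

Lemma tn1 a : 0 <= a <= 1 -> a ** 1 = a. Proof. exact: (tnorm1 tnP). Qed.

Lemma t1n a : 0 <= a <= 1 -> 1 ** a = a.
Proof. by move=> ha; rewrite tnC ?tn1//; u01. Qed.

Lemma tn_lel a b : 0 <= a <= 1 -> 0 <= b <= 1 -> a ** b <= a.
Proof.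
move=> ha hb; rewrite -[leRHS]tn1//.
by apply: tn_le => //; auto with unit01; case/andP: hb.
Qed.

Lemma tn_ler a b : 0 <= a <= 1 -> 0 <= b <= 1 -> a ** b <= b.
Proof. by move=> ha hb; rewrite tnC// tn_lel. Qed.

Lemma tn0 a : 0 <= a <= 1 -> a ** 0 = 0.
Proof.
move=> ha; apply/eqP; rewrite eq_le tn_ler//=; auto with unit01.
by case/andP: (tn_01 ha (zero_01 R)).
Qed.

Lemma t0n a : 0 <= a <= 1 -> 0 ** a = 0.
Proof. by move=> ha; rewrite tnC ?tn0//; u01. Qed.

Lemma tn_continuous_curve (u v : R -> R) :
  continuous u -> continuous v ->
  (forall x, 0 <= x <= 1 -> 0 <= u x <= 1) ->
  (forall x, 0 <= x <= 1 -> 0 <= v x <= 1) ->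
  {within `[0, 1]%classic, continuous (fun x => u x ** v x)}.
Proof.
move=> cu cv hu hv; apply/subspace_continuousP => x /= x01.
move: x01; rewrite in_itv/= => x01.
have /subspace_continuousP/(_ (u x, v x)) := tnorm_continuous tnP.
have uvx : (`[0, 1]%classic `*` `[0, 1]%classic : set (R * R)) (u x, v x).
  by split; rewrite /= in_itv/=; auto.
move=> /(_ uvx) h.
have huv : (fun y => (u y, v y)) @ x --> (u x, v x).
  exact: (cvg_pair (cu x) (cv x)).
apply: (@cvg_comp _ _ _ (fun y => (u y, v y)) (fun p => p.1 ** p.2)
  _ _ _ _ h).
move=> W hW; have hW' : \forall y \near x,
  (`[0, 1]%classic `*` `[0, 1]%classic : set (R * R)) (u y, v y) ->
  W (u y, v y) := huv _ hW.
suff : \forall y \near x, y \in `[0, 1] -> W (u y, v y) by [].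
near=> y => y01.
have /= := near hW' y; rewrite in_itv/= in y01; apply => //.
by split; rewrite /= in_itv/=; auto.
Unshelve. all: by end_near. Qed.

(** Together with monotonicity, all that is used of continuity is that the
translations and the squaring map take every intermediate value. *)
Lemma tn_ivt a c : 0 <= a <= 1 -> 0 <= c <= a ->
  exists2 b, 0 <= b <= 1 & a ** b = c.
Proof.
move=> ha hc.
have cont : {within `[0, 1]%classic, continuous (fun x => a ** x)}.
  apply: (@tn_continuous_curve (fun=> a) id) => //.
    by move=> ?; exact: cvg_cst.
  by move=> ?; exact: cvg_id.
have [||b] := @IVT R (fun x => a ** x) 0 1 c _ cont; rewrite ?ler01//.
  by rewrite tn0// tn1// min_l ?max_r//; case/andP: ha.
by rewrite in_itv/= => hb <-; exists b.
Qed.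

Lemma tn_square_ivt c : 0 <= c <= 1 -> exists2 b, 0 <= b <= 1 & b ** b = c.
Proof.
move=> hc.
have cont : {within `[0, 1]%classic, continuous (fun x => x ** x)}.
  by apply: (@tn_continuous_curve id id) => // ?; exact: cvg_id.
have [||b] := @IVT R (fun x => x ** x) 0 1 c _ cont; rewrite ?ler01//.
  rewrite (tn0 (zero_01 R)) (tn1 (one_01 R)).
  by rewrite min_l ?max_r ?ler01.
by rewrite in_itv/= => hb <-; exists b.
Qed.

Lemma ge_timpl a b c : 0 <= c <= 1 -> a ** c <= b -> c <= a --o b.
Proof. by move=> hc acb; apply: ub_le_sup => //; exists 1 => x [/andP[]]. Qed.

(** If the product exceeded [b], an intermediate value above [b] would be taken
strictly below the supremum that defines [a --o b]. *)
Lemma tn_timpl_le a b : 0 <= a <= 1 -> 0 <= b <= 1 -> a ** (a --o b) <= b.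
Proof.
move=> ha hb; rewrite leNgt; apply/negP => bv.
have hav : 0 <= a ** (a --o b) <= 1 by u01.
have [m [hm bm mv]] := mid_01 hb hav bv.
have ma : 0 <= m <= a.
  case/andP: hm => -> _ /=; apply: le_trans (ltW mv) _.
  by apply: tn_lel => //; u01.
have [d hd ad] := tn_ivt ha ma.
have dlt : d < a --o b.
  rewrite ltNge; apply/negP => h; have : a ** (a --o b) <= a ** d.
    by apply: tn_le; auto with unit01.
  by rewrite ad leNgt mv.
have [|c [hc acb] dc] := sup_gt _ dlt.
  by exists 0; split; [u01|rewrite tn0//; case/andP: hb].
suff : m <= b by rewrite leNgt bm.
rewrite -ad; apply: le_trans acb; apply: tn_le => //; exact: ltW.
Qed.

Lemma le_timpl a b c : 0 <= a <= 1 -> 0 <= b <= 1 -> 0 <= c <= 1 ->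
  (c <= a --o b) = (a ** c <= b).
Proof.
move=> ha hb hc; apply/idP/idP => [h|]; last exact: ge_timpl.
apply: le_trans (tn_timpl_le ha hb); apply: tn_le; auto with unit01.
Qed.

Lemma lt_timpl a b c : 0 <= a <= 1 -> 0 <= b <= 1 -> 0 <= c <= 1 ->
  (a --o b < c) = (b < a ** c).
Proof. by move=> *; rewrite !ltNge le_timpl. Qed.

Lemma tn_timpl a b : 0 <= a <= 1 -> 0 <= b <= a -> a ** (a --o b) = b.
Proof.
move=> ha hb; have hb1 : 0 <= b <= 1 by lra.
apply/eqP; rewrite eq_le tn_timpl_le//=.
have [c hc ac] := tn_ivt ha hb.
rewrite -[leLHS]ac; apply: tn_le => //; first u01.
by rewrite le_timpl// ac.
Qed.

Lemma timpl_ge a b : 0 <= a <= 1 -> 0 <= b <= 1 -> b <= a --o b.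
Proof. by move=> ha hb; rewrite le_timpl// tn_ler. Qed.

Lemma timpl1 a b : 0 <= a <= 1 -> 0 <= b <= 1 -> a <= b -> a --o b = 1.
Proof.
move=> ha hb ab; apply/eqP; rewrite eq_le; case/andP: (timpl_01 a b) => _ -> /=.
by rewrite le_timpl ?tn1//; u01.
Qed.

(** The multiplicative counterpart of [(q - s) + (s - r) = q - r]; it makes the
index relation of a flat weight transitive. *)
Lemma timpl_chain q r s : 0 <= q <= 1 -> 0 <= r <= 1 -> 0 <= s <= 1 ->
  r <= s -> s <= q -> q --o r <= (q --o s) ** (s --o r).
Proof.
move=> hq hr hs rs sq; set v := q --o s; set w := q --o r.
have [hv hw] : 0 <= v <= 1 /\ 0 <= w <= 1 by split; exact: timpl_01.
have wv : w <= v.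
  rewrite le_timpl//; apply: le_trans rs; exact: tn_timpl_le.
have -> : w = v ** (v --o w) by rewrite tn_timpl//; lra.
apply: tn_le; auto with unit01.
have qv : q ** v = s by rewrite tn_timpl//; lra.
rewrite le_timpl//; last u01.
rewrite -[X in X ** _]qv -tnA//; last u01.
rewrite tn_timpl//; last lra.
exact: tn_timpl_le.
Qed.

(** A strict inequality survives a slight decrease of one factor, the decreased
factor being a residuum. *)
Lemma lt_tn_approxl a b c : 0 <= a <= 1 -> 0 <= b <= 1 -> 0 <= c <= 1 ->
  c < a ** b -> exists a', [/\ 0 <= a' <= 1, a' < a & c < a' ** b].
Proof.
move=> ha hb hc cab; have hab : 0 <= a ** b <= 1 by u01.
have [m [hm cm mab]] := mid_01 hc hab cab.
exists (b --o m); split; first u01.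
  by rewrite lt_timpl// tnC.
rewrite tnC//; last u01.
rewrite tn_timpl//; move: (tn_ler ha hb); lra.
Qed.

Lemma lt_tn_approxr a b c : 0 <= a <= 1 -> 0 <= b <= 1 -> 0 <= c <= 1 ->
  c < a ** b -> exists b', [/\ 0 <= b' <= 1, b' < b & c < a ** b'].
Proof.
move=> ha hb hc; rewrite tnC// => /(lt_tn_approxl hb ha hc)[b' [hb' b'b cb']].
by exists b'; split; rewrite // tnC.
Qed.

Lemma tn_join01_le (I : Type) (P : set I) (F : I -> R) a b :
  0 <= a <= 1 -> 0 <= b <= 1 -> (forall i, 0 <= F i <= 1) ->
  (forall i, P i -> a ** F i <= b) -> a ** join01 P F <= b.
Proof.
move=> ha hb hF h; rewrite -le_timpl//; last u01.
apply: join01_lub => [|i Pi]; last by rewrite le_timpl//; exact: h.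
by case/andP: (timpl_01 a b).
Qed.

End Tnorm.

#[local] Hint Resolve tn_01 timpl_01 : unit01.

(** * Powers, idempotents and cancellation *)

Definition idempotent_free (R : realType) (tn : R -> R -> R) : Prop :=
  forall e : R, 0 <= e <= 1 -> tn e e = e -> e = 0 \/ e = 1.

Definition cancellative (R : realType) (tn : R -> R -> R) : Prop :=
  forall a b c : R, 0 <= a <= 1 -> 0 <= b <= 1 -> 0 <= c <= 1 ->
    0 < tn a c -> tn a c <= tn b c -> a <= b.

Definition tpow (R : realType) (tn : R -> R -> R) (x : R) (n : nat) : R :=
  iter n (tn x) 1.

Section Archimedean.
Variables (R : realType) (tn : R -> R -> R).
Hypothesis tnP : continuous_tnorm tn.
Local Notation "a ** b" := (tn a b) (at level 40, left associativity).
Local Notation "a --o b" := (timpl tn a b) (at level 45, right associativity).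
Implicit Types a b c d e x : R.

Lemma tpow_01 x n : 0 <= x <= 1 -> 0 <= tpow tn x n <= 1.
Proof. by move=> hx; elim: n => [|n IH] /=; auto with unit01. Qed.

#[local] Hint Resolve tpow_01 : unit01.

Lemma tpow1 x : 0 <= x <= 1 -> tpow tn x 1 = x.
Proof. exact: (tn1 tnP). Qed.

Lemma tpowD x m n : 0 <= x <= 1 ->
  tpow tn x (m + n) = tpow tn x m ** tpow tn x n.
Proof.
move=> hx; elim: m => [|m IH]; first by rewrite (t1n tnP)//; u01.
by rewrite addSn /= IH (tnA tnP)//; u01.
Qed.

Lemma tpowM x m n : 0 <= x <= 1 ->
  tpow tn x (m * n) = tpow tn (tpow tn x m) n.
Proof.
move=> hx; elim: n => [|n IH]; first by rewrite muln0.
by rewrite mulnS tpowD// IH.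
Qed.

Lemma tpow_anti x m n : 0 <= x <= 1 -> (m <= n)%N ->
  tpow tn x n <= tpow tn x m.
Proof. by move=> hx /subnKC <-; rewrite tpowD// (tn_lel tnP)//; u01. Qed.

Hypothesis idem : idempotent_free tn.

(** The infimum of the powers of [d] is idempotent, since squaring takes
intermediate values; hence it is 0 as soon as [d] is not 1. *)
Lemma le_tpow_eq0 d x : 0 <= d <= 1 -> d < 1 -> 0 <= x <= 1 ->
  (forall n, x <= tpow tn d n) -> x = 0.
Proof.
move=> hd d1 hx xd; set e := meet01 [set: nat] (tpow tn d).
have he : 0 <= e <= 1 by apply: meet01_01 => n; u01.
have ed n : e <= tpow tn d n by apply: meet01_lb => // m; u01.
have xe : x <= e by apply: meet01_glb => //; case/andP: hx.
have ee : e ** e = e.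
  apply/eqP; rewrite eq_le tn_lel//= leNgt; apply/negP => lt_ee.
  have [m [hm em me]] := mid_01 (tn_01 tnP he he) he lt_ee.
  have [y hy ym] := tn_square_ivt tnP hm.
  have ey : e < y.
    rewrite ltNge; apply/negP => ye.
    by have := tn_le tnP hy he hy he ye ye; rewrite ym leNgt em.
  have [n dn] : exists n, tpow tn d n < y.
    apply: contrapT => nh; move: ey; apply/negP; rewrite -leNgt.
    apply: meet01_glb => [|n _]; first by case/andP: hy.
    by rewrite leNgt; apply/negP => h; apply: nh; exists n.
  have := ed (n + n)%N; apply/negP; rewrite -ltNge; apply: le_lt_trans me.
  by rewrite tpowD// -ym; apply: (tn_le tnP); auto with unit01; exact: ltW.
have e1 : e <= d by have := ed 1%N; rewrite tpow1.
by case: (idem he ee) => e01; lra.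
Qed.

Lemma tn_absorb_eq0 d x : 0 <= d <= 1 -> d < 1 -> 0 <= x <= 1 ->
  x <= x ** d -> x = 0.
Proof.
move=> hd d1 hx xd; apply: (le_tpow_eq0 hd d1 hx) => n.
suff : x <= x ** tpow tn d n by move/le_trans; apply; apply: tn_ler; u01.
elim: n => [|n IH]; first by rewrite (tn1 tnP).
apply: le_trans xd _; rewrite /= (tnCA tnP)//; last u01.
by rewrite (tnC tnP (b := d))//; apply: (tn_le tnP); auto with unit01.
Qed.

(** If [b < a] then [b = a ** d] with [d = a --o b < 1], so that
[a ** c <= b ** c] makes [a ** c] absorb [d]. *)
Lemma idempotent_free_cancellative : cancellative tn.
Proof.
move=> a b c ha hb hc ac0 acbc; rewrite leNgt; apply/negP => ba.
set d := a --o b; have hd : 0 <= d <= 1 by exact: timpl_01.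
have d1 : d < 1 by rewrite (lt_timpl tnP)// ?(tn1 tnP)//; u01.
have bad : b = a ** d by rewrite (tn_timpl tnP)//; lra.
suff : a ** c = 0 by move=> h; rewrite h ltxx in ac0.
apply: (tn_absorb_eq0 hd d1); first u01.
by rewrite (tnAC tnP)// -bad.
Qed.

End Archimedean.

#[local] Hint Resolve tpow_01 : unit01.

Section CancellationByTransport.
Variables (R : realType) (tn tn' : R -> R -> R).
Hypothesis tnP : continuous_tnorm tn.

Lemma cancellative_isomorphic :
  tnorm_isomorphic tn tn' -> cancellative tn' -> cancellative tn.
Proof.
move=> [f [[fun_f _ surj_f] mono_f morph_f]] canc a b c ha hb hc ac0 acbc.
have f01 x : 0 <= x <= 1 -> 0 <= f x <= 1.
  by move=> hx; have := fun_f x; rewrite /= !in_itv/=; apply.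
have f0 : f 0 = 0.
  have [y /=] := surj_f 0 ltac:(by rewrite /= in_itv/= lexx ler01).
  rewrite in_itv/= => hy fy0.
  apply/eqP; rewrite eq_le; case/andP: (f01 0 (zero_01 R)) => -> _.
  by rewrite -[X in _ <= X]fy0 mono_f//; [case/andP: hy => ->|exact: zero_01].
have hac : 0 <= tn a c <= 1 by exact: tn_01.
have hbc : 0 <= tn b c <= 1 by exact: tn_01.
rewrite -mono_f//; apply: (canc _ _ (f c)); auto.
  by rewrite -morph_f// ltNge -f0 mono_f ?zero_01// -ltNge.
by rewrite -!morph_f// mono_f.
Qed.

End CancellationByTransport.

Lemma lukasiewicz_cancellative (R : realType) : cancellative (@lukasiewicz R).
Proof.
move=> a b c _ _ _; rewrite /lukasiewicz /Num.max.
by case: ifP => _; case: ifP => _; lra.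
Qed.

Lemma product_cancellative (R : realType) : cancellative (@product_tnorm R).
Proof.
move=> a b c ha hb hc; rewrite /product_tnorm => ac0.
have c0 : 0 < c.
  by rewrite lt_neqAle eq_sym; case/andP: hc => -> _; rewrite andbT;
     apply: contraTneq ac0 => ->; rewrite mulr0 ltxx.
by rewrite ler_pM2r.
Qed.

#[local] Hint Resolve dhom_01 : unit01.

(** * Weights and coweights on an ordered fuzzy set *)

Section Dcat.
Variables (R : realType) (tn : R -> R -> R).
Hypothesis tnP : continuous_tnorm tn.
Local Notation "a ** b" := (tn a b) (at level 40, left associativity).
Local Notation "a --o b" := (timpl tn a b) (at level 45, right associativity).
Variable A : dcat tn.
Implicit Types (x y z : A) (phi psi : A -> R) (c d t : R).

(** Since [dhom x y = dhom x x ** rhom x y], passing to [rhom] gives a category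
whose objects all have type 1; [rweight] does the same for weights. Coweights are
unchanged, and their type is only an upper bound. *)
Definition rhom x y : R := dhom x x --o dhom x y.

Definition rweight phi x : R := dhom x x --o phi x.

Lemma rhom_01 x y : 0 <= rhom x y <= 1. Proof. exact: timpl_01. Qed.

Lemma rweight_01 phi x : 0 <= rweight phi x <= 1.
Proof. exact: timpl_01. Qed.

#[local] Hint Resolve rhom_01 rweight_01 : unit01.

Lemma dhom_le_source x y : dhom x y <= dhom x x.
Proof. by have := dhom_le x y; rewrite le_min => /andP[]. Qed.

Lemma dhom_le_target x y : dhom x y <= dhom y y.
Proof. by have := dhom_le x y; rewrite le_min => /andP[]. Qed.

Lemma dhomE x y : dhom x x ** rhom x y = dhom x y.
Proof.
rewrite (tn_timpl tnP) ?dhom_01// dhom_le_source andbT.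
by case/andP: (dhom_01 x y).
Qed.

Lemma rhomxx x : rhom x x = 1.
Proof. by rewrite /rhom (timpl1 tnP)//; u01. Qed.

Lemma rhom_dhom x y z : rhom y z ** dhom x y <= dhom x z.
Proof. exact: dhom_comp. Qed.

Lemma rhom_comp x y z : rhom x y ** rhom y z <= rhom x z.
Proof.
rewrite {3}/rhom (le_timpl tnP)//; auto with unit01.
by rewrite (tnA tnP) ?dhomE 1?(tnC tnP) ?rhom_dhom//; u01.
Qed.

Section Weight.
Variables (phi : A -> R) (t : R).
Hypothesis phiP : is_weight phi t.

Lemma weight_t01 : 0 <= t <= 1. Proof. by case: phiP. Qed.

Lemma weight_01 x : 0 <= phi x <= 1. Proof. by case: phiP. Qed.

#[local] Hint Resolve weight_t01 weight_01 : unit01.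

Lemma weight_le_type x : phi x <= t.
Proof. by case: phiP => _ _ /(_ x) + _; rewrite le_min => /andP[]. Qed.

Lemma weight_le_dhom x : phi x <= dhom x x.
Proof. by case: phiP => _ _ /(_ x) + _; rewrite le_min => /andP[]. Qed.

Lemma weightE x : dhom x x ** rweight phi x = phi x.
Proof.
rewrite (tn_timpl tnP) ?dhom_01// weight_le_dhom andbT.
by case/andP: (weight_01 x).
Qed.

End Weight.

Section Coweight.
Variables (psi : A -> R) (t : R).
Hypothesis psiP : is_coweight psi t.

Lemma coweight_t01 : 0 <= t <= 1. Proof. by case: psiP. Qed.

Lemma coweight_01 x : 0 <= psi x <= 1. Proof. by case: psiP. Qed.

#[local] Hint Resolve coweight_t01 coweight_01 : unit01.

Lemma coweight_le_type x : psi x <= t.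
Proof. by case: psiP => _ _ /(_ x) + _; rewrite le_min => /andP[]. Qed.

Lemma coweight_le_dhom x : psi x <= dhom x x.
Proof. by case: psiP => _ _ /(_ x) + _; rewrite le_min => /andP[]. Qed.

Lemma coweight_rhom x y : rhom x y ** psi x <= psi y.
Proof. by case: psiP => _ _ _; apply. Qed.

Lemma coweightE x : t ** (t --o psi x) = psi x.
Proof.
rewrite (tn_timpl tnP) ?coweight_t01// coweight_le_type andbT.
by case/andP: (coweight_01 x).
Qed.

End Coweight.

Lemma wcomp_ub phi psi x : (forall y, 0 <= psi y <= 1) ->
  rweight phi x ** psi x <= wcomp phi psi.
Proof.
move=> hpsi; apply: (join01_ub (F := fun y => rweight phi y ** psi y)) => //.
by move=> y; u01.
Qed.

Lemma wcomp_lub phi psi c : 0 <= c ->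
  (forall x, rweight phi x ** psi x <= c) -> wcomp phi psi <= c.
Proof. by move=> c0 h; apply: join01_lub => // x _; exact: h. Qed.

Lemma lt_wcomp phi psi c : 0 <= c -> c < wcomp phi psi ->
  exists x, c < rweight phi x ** psi x.
Proof. by move=> c0 /(lt_join01 c0)[x _ h]; exists x. Qed.

Lemma wcomp_01 phi psi : (forall y, 0 <= psi y <= 1) ->
  0 <= wcomp phi psi <= 1.
Proof. by move=> hpsi; apply: join01_01 => y; u01. Qed.

(** * Every Cauchy weight is flat *)

Section CauchyFlat.
Variables (phi psi : A -> R) (t : R).
Hypotheses (phiP : is_weight phi t) (psiP : is_coweight psi t).
Hypothesis unit : t <= wcomp phi psi.
Hypothesis counit : forall x y, (t --o psi y) ** phi x <= dhom x y.

(** The left adjoint of composition with [phi]; it is the reason why the latter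
preserves meets. The bound of [theta] by the types is what lets the counit
inequality act on [theta]. *)
Lemma wcomp_adjoint theta d : (forall y, 0 <= theta y <= 1) ->
  (forall x, theta x <= dhom x x) ->
  (forall x y, rhom x y ** theta x <= theta y) -> 0 <= d <= 1 -> d <= t ->
  (d <= wcomp phi theta) <-> (forall y, (t --o psi y) ** d <= theta y).
Proof.
move=> htheta theta_le theta_act hd dt; have ht := weight_t01 phiP.
have hphi := weight_01 phiP; have hpsi := coweight_01 psiP.
split=> [le_d y|h].
  apply: (@le_trans _ _ ((t --o psi y) ** wcomp phi theta)).
    by apply: (tn_le tnP); auto with unit01; exact: wcomp_01.
  apply: (tn_join01_le tnP); auto with unit01 => x _.
  apply: le_trans (theta_act x y).
  have -> : theta x = dhom x x ** (dhom x x --o theta x).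
    by rewrite (tn_timpl tnP) ?dhom_01// theta_le andbT; case/andP: (htheta x).
  rewrite !(tnA tnP); auto 6 with unit01.
  rewrite -(tnA tnP (a := t --o psi y)); auto with unit01.
  rewrite (tnC tnP (a := rweight phi x)); auto with unit01.
  rewrite (weightE phiP) (tnC tnP (a := rhom x y)) ?dhomE; auto with unit01.
  by apply: (tn_le tnP); auto with unit01.
have td : t ** (t --o d) = d.
  by rewrite (tn_timpl tnP)// dt andbT; case/andP: hd.
have -> : d = (t --o d) ** t by rewrite (tnC tnP)//; u01.
apply: le_trans (tn_le tnP _ _ _ _ (lexx _) unit) _; auto with unit01.
  exact: wcomp_01.
apply: (tn_join01_le tnP); auto with unit01.
  exact: wcomp_01.
move=> x _.
apply: le_trans (wcomp_ub phi x htheta).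
rewrite (tnCA tnP); auto with unit01.
apply: (tn_le tnP); auto with unit01.
apply: le_trans (h x).
rewrite -[X in _ ** X](coweightE psiP) (tnA tnP); auto with unit01.
rewrite (tnC tnP (a := t --o d)); auto with unit01.
by rewrite td (tnC tnP)//; u01.
Qed.

Lemma wcomp_le_type theta : (forall y, 0 <= theta y <= 1) ->
  (forall x, theta x <= dhom x x) -> wcomp phi theta <= t.
Proof.
move=> htheta theta_le; have ht := weight_t01 phiP.
apply: wcomp_lub => [|x]; first by case/andP: ht.
apply: le_trans (weight_le_type phiP x); rewrite -(weightE phiP x).
rewrite (tnC tnP); auto with unit01.
by apply: (tn_le tnP); auto with unit01.
Qed.

Lemma unit_counit_flat : flat_weight phi t.
Proof.
have ht := weight_t01 phiP; split=> // [b hb|psi1 psi2 u psi1P psi2P].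
  have hm x : 0 <= Num.min b (dhom x x) <= 1 by u01.
  have act x y : rhom x y ** Num.min b (dhom x x) <= Num.min b (dhom y y).
    rewrite le_min; apply/andP; split.
      apply: le_trans (tn_ler tnP (rhom_01 x y) (hm x)) _.
      by rewrite ge_min lexx.
    apply: le_trans (dhom_le_target x y); rewrite -(dhomE x y) (tnC tnP)//.
      apply: (tn_le tnP); auto with unit01.
      by rewrite ge_min lexx orbT.
    u01.
  have le_d x : Num.min b (dhom x x) <= dhom x x by rewrite ge_min lexx orbT.
  apply/eqP; rewrite eq_le le_min wcomp_le_type// andbT; apply/andP; split.
    apply: wcomp_lub => [|x]; first by case/andP: hb.
    apply: le_trans (tn_ler tnP (rweight_01 phi x) (hm x)) _.
    by rewrite ge_min lexx.
  apply/wcomp_adjoint => //; first u01.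
    by rewrite ge_min lexx orbT.
  move=> y; have hpy := coweight_01 psiP y; rewrite le_min; apply/andP; split.
    apply: le_trans (tn_ler tnP _ _) _; auto with unit01.
    by rewrite ge_min lexx.
  apply: le_trans (coweight_le_dhom psiP y).
  rewrite -[leRHS](coweightE psiP) (tnC tnP); auto with unit01.
  by apply: (tn_le tnP); auto with unit01; rewrite ge_min lexx orbT.
have h1 := coweight_01 psi1P; have h2 := coweight_01 psi2P.
have hm x : 0 <= Num.min (psi1 x) (psi2 x) <= 1 by u01.
have w1 := wcomp_01 phi h1; have w2 := wcomp_01 phi h2.
apply/eqP; rewrite eq_le le_min; apply/andP; split.
  apply/andP; split.
    apply: wcomp_lub => [|x]; first by case/andP: w1.
    apply: le_trans (wcomp_ub phi x h1).
    by apply: (tn_le tnP); auto with unit01; rewrite ge_min lexx.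
  apply: wcomp_lub => [|x]; first by case/andP: w2.
  apply: le_trans (wcomp_ub phi x h2).
  by apply: (tn_le tnP); auto with unit01; rewrite ge_min lexx orbT.
have le1 := coweight_le_dhom psi1P; have le2 := coweight_le_dhom psi2P.
set d := Num.min (wcomp phi psi1) (wcomp phi psi2).
have hd : 0 <= d <= 1 by exact: min_01.
have dt : d <= t by rewrite ge_min wcomp_le_type.
have act1 := coweight_rhom psi1P; have act2 := coweight_rhom psi2P.
have [d1 d2] : d <= wcomp phi psi1 /\ d <= wcomp phi psi2.
  by rewrite !ge_min !lexx orbT.
apply/wcomp_adjoint => // [x|x y|y].
- by rewrite ge_min le1.
- rewrite le_min; apply/andP; split.
    apply: le_trans (act1 x y); apply: (tn_le tnP); auto with unit01.
    by rewrite ge_min lexx.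
  apply: le_trans (act2 x y); apply: (tn_le tnP); auto with unit01.
  by rewrite ge_min lexx orbT.
- rewrite le_min; apply/andP; split.
    exact: ((wcomp_adjoint h1 le1 act1 hd dt).1 d1).
  exact: ((wcomp_adjoint h2 le2 act2 hd dt).1 d2).
Qed.

End CauchyFlat.

Lemma cauchy_weight_flat phi t : cauchy_weight phi t -> flat_weight phi t.
Proof. by move=> [phiP [psi [psiP]]]; exact: unit_counit_flat. Qed.

End Dcat.

#[local] Hint Resolve rhom_01 rweight_01 : unit01.

(** * Suprema as limits of approximating nets *)

Section Approximation.
Variables (R : realType) (tn : R -> R -> R).
Hypotheses (tnP : continuous_tnorm tn) (canc : cancellative tn).
Local Notation "a ** b" := (tn a b) (at level 40, left associativity).
Local Notation "a --o b" := (timpl tn a b) (at level 45, right associativity).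
Variable A : dcat tn.
Implicit Types (x y z : A) (c d : R).

Lemma tn_lt (a b c : R) : 0 <= a <= 1 -> 0 <= b <= 1 -> 0 <= c <= 1 ->
  0 < b ** c -> a < b -> a ** c < b ** c.
Proof.
move=> ha hb hc bc0; rewrite ltNge => /negP ba; rewrite ltNge; apply/negP.
by move=> h; apply: ba; apply: (canc hb ha hc).
Qed.

Variables (phi : A -> R) (t : R).
Hypotheses (phiP : is_weight phi t) (t_gt0 : 0 < t).

Let ht : 0 <= t <= 1. Proof. exact: weight_t01 phiP. Qed.
Let hphi x : 0 <= phi x <= 1. Proof. exact: weight_01 phiP x. Qed.

(** The infimum in the definition of a supremum is the greatest [m] with
[m ** phi x <= dhom x y] for all [x]. That [dhom s y] is below the required value
follows from [phi x <= dhom x s] by composition. *)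
Lemma is_supremum_of_le s : dhom s s = t -> (forall x, phi x <= dhom x s) ->
  (forall y m, 0 <= m <= 1 -> (forall x, m ** phi x <= dhom x y) ->
     m ** t <= dhom s y) ->
  is_supremum phi t s.
Proof.
move=> sst phi_s m_le; split=> // y.
have h01 x : 0 <= phi x --o dhom x y <= 1 by u01.
have hm := meet01_01 [set: A] h01; set m := meet01 _ _ in hm *.
have m_phi x : m ** phi x <= dhom x y.
  rewrite (tnC tnP)// -(le_timpl tnP)//; last u01.
  exact: meet01_lb.
have sy_t : dhom s y <= t by rewrite -sst dhom_le_source.
have t_sy : t ** (t --o dhom s y) = dhom s y.
  by rewrite (tn_timpl tnP)// sy_t andbT; case/andP: (dhom_01 s y).
apply/eqP; rewrite eq_le le_min dhom_le_target /=; apply/andP; split.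
  rewrite -[leLHS]t_sy (tnC tnP)//; last u01.
  apply: (tn_le tnP) => //; first u01.
  apply: meet01_glb => [|x _]; first by case/andP: (timpl_01 tn t (dhom s y)).
  rewrite (le_timpl tnP)//; auto with unit01.
  apply: (@le_trans _ _ ((t --o dhom s y) ** dhom x s)).
    by rewrite (tnC tnP)//; [apply: (tn_le tnP); auto with unit01|u01].
  by have := rhom_dhom x s y; rewrite /rhom sst.
by rewrite ge_min m_le ?orbT.
Qed.

Variables (I : Type) (le : I -> I -> Prop) (x : I -> A).
Hypothesis dir : directed_preorder le.

(** What makes limits of a net suprema of [phi], for the net of a flat weight
and for that of a Cauchy weight. By the first two properties the types along the
net tend to [t]; the third places [phi] below the weights represented by the
net. *)
Record approximates : Prop := Approximates {
  approximates_rweight c : 0 <= c <= 1 -> c < 1 ->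
    ultimately le (fun s => c <= rweight phi (x s));
  approximates_weight c : 0 <= c <= 1 -> c < t ->
    ultimately le (fun s => c <= phi (x s));
  approximates_dhom z c : 0 <= c <= 1 -> c < phi z ->
    ultimately le (fun s => c <= dhom z (x s))
}.

Hypothesis appr : approximates.

Lemma ultimately_type_le c : t < c ->
  ultimately le (fun s => dhom (x s) (x s) <= c).
Proof.
move=> tc; have [c1|c1] := leP 1 c.
  have [l0] := directed_inhabited dir; exists l0 => s _.
  by apply: le_trans c1; case/andP: (dhom_01 (x s) (x s)).
have hc : 0 <= c <= 1 by move: ht; lra.
have [|r [hr r1 trc]] := lt_tn_approxl tnP (one_01 R) hc ht.
  by rewrite (t1n tnP).
have [l hl] := approximates_rweight appr hr r1; exists l => s ls.
rewrite leNgt; apply/negP => cs; have := weight_le_type phiP (x s).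
apply/negP; rewrite -ltNge; apply: lt_le_trans trc _.
rewrite -(weightE tnP phiP (x s)) (tnC tnP); auto with unit01.
by apply: (tn_le tnP); auto with unit01; exact: ltW.
Qed.

Lemma type_limit : liminf01 le (fun s => dhom (x s) (x s)) = t.
Proof.
apply: liminf01_limit => //; auto with unit01; last exact: ultimately_type_le.
move=> c c0 ct; have [||l hl] := @approximates_weight appr c => //.
  by move: ht; lra.
by exists l => s ls; apply: le_trans (hl s ls) (weight_le_dhom phiP _).
Qed.

(** Here cancellation is indispensable: [rhom (x s) a] is the residuum of two
quantities that tend to [t], and for an idempotent [t < 1] it may stay away
from 1. *)
Lemma ultimately_rhom_ge a c :
  (forall d, 0 <= d <= 1 -> d < t ->
     ultimately le (fun s => d <= dhom (x s) a)) ->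
  0 <= c <= 1 -> c < 1 -> ultimately le (fun s => c <= rhom (x s) a).
Proof.
move=> lim hc c1; have hct : 0 <= c ** t <= 1 by u01.
have ctt : c ** t < t.
  rewrite -[ltRHS](t1n tnP)//; apply: tn_lt; auto with unit01.
  by rewrite (t1n tnP).
have [d [hd ctd dt]] := mid_01 hct ht ctt.
have [|r [hr r1 ctrd]] := lt_tn_approxl tnP (one_01 R) hd hct.
  by rewrite (t1n tnP).
have [l hl] := ultimately_and dir (approximates_rweight appr hr r1) (lim d hd dt).
exists l => s /hl[rs ds].
rewrite /rhom (le_timpl tnP)//; auto with unit01.
apply: le_trans ds; rewrite leNgt; apply/negP => dac.
(* the type of [x s] may exceed [t], but not after multiplication by [r] *)
have : r ** (dhom (x s) (x s) ** c) <= c ** t.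
  rewrite (tnA tnP) 1?(tnC tnP (a := c)); auto with unit01.
  apply: (tn_le tnP); auto with unit01.
  apply: le_trans (weight_le_type phiP (x s)).
  rewrite -(weightE tnP phiP (x s)) (tnC tnP (a := r)); auto with unit01.
  by apply: (tn_le tnP); auto with unit01.
apply/negP; rewrite -ltNge; apply: lt_le_trans ctrd _.
by apply: (tn_le tnP); auto with unit01; exact: ltW.
Qed.

Lemma weight_le_limit a z :
  (forall d, 0 <= d <= 1 -> d < t ->
     ultimately le (fun s => d <= dhom (x s) a)) ->
  phi z <= dhom z a.
Proof.
move=> lim; rewrite leNgt; apply/negP => lt_phi.
have hza := dhom_01 z a.
have [|c [hc c1 hcz]] := lt_tn_approxl tnP (one_01 R) (hphi z) hza.
  by rewrite (t1n tnP).
have [d [hd dz hcd]] := lt_tn_approxr tnP hc (hphi z) hza hcz.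
have [s [h1 h2]] := ultimately_ex dir (ultimately_and dir
  (ultimately_rhom_ge lim hc c1) (approximates_dhom appr hd dz)).
suff : c ** d <= dhom z a by rewrite leNgt hcd.
apply: le_trans (rhom_dhom z (x s) a); apply: (tn_le tnP); auto with unit01.
Qed.

Lemma yoneda_limit_supremum a : yoneda_limit le x a -> is_supremum phi t a.
Proof.
move=> [aa ay]; rewrite type_limit in aa.
have lim d : 0 <= d <= 1 -> d < t -> ultimately le (fun s => d <= dhom (x s) a).
  move=> /andP[d0 _] dt; apply: lt_liminf01 => //; last by rewrite -ay aa.
  by auto with unit01.
apply: is_supremum_of_le => // [z|y m hm mphi]; first exact: weight_le_limit.
rewrite leNgt; apply/negP => lt_mt; have hay := dhom_01 a y.
have [d [hd dt ltd]] := lt_tn_approxr tnP hm ht hay lt_mt.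
suff : m ** d <= dhom a y by rewrite leNgt ltd.
rewrite ay; apply: ge_liminf01; auto with unit01.
  by case/andP: (tn_01 tnP hm hd).
have [l hl] := approximates_weight appr hd dt; exists l => s ls.
by apply: le_trans (mphi (x s)); apply: (tn_le tnP); auto with unit01.
Qed.

Lemma bilimit_supremum a : bilimit le x a -> is_supremum phi t a.
Proof.
move=> [xa ax xx]; rewrite type_limit in xx; rewrite xx in xa ax.
have lim d : 0 <= d <= 1 -> d < t -> ultimately le (fun s => d <= dhom (x s) a).
  move=> /andP[d0 _] dt; apply: lt_liminf01; rewrite -?xa//.
  by auto with unit01.
have lim' d : 0 <= d <= 1 -> d < t ->
    ultimately le (fun s => d <= dhom a (x s)).
  move=> /andP[d0 _] dt; apply: lt_liminf01; rewrite -?ax//.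
  by auto with unit01.
apply: is_supremum_of_le => // [z|y m hm mphi]; first exact: weight_le_limit.
rewrite leNgt; apply/negP => lt_mt; have hay := dhom_01 a y.
have [d [hd dt ltd]] := lt_tn_approxr tnP hm ht hay lt_mt.
have hmd : 0 <= m ** d <= 1 by u01.
have [|c [hc c1 ltc]] := lt_tn_approxr tnP hmd (one_01 R) hay.
  by rewrite (tn1 tnP).
have [s [h1 h2]] := ultimately_ex dir (ultimately_and dir
  (approximates_rweight appr hc c1) (lim' d hd dt)).
suff : m ** d ** c <= dhom a y by rewrite leNgt ltc.
apply: le_trans (rhom_dhom a (x s) y).
rewrite (tnAC tnP)//; apply: (tn_le tnP); auto with unit01.
rewrite /rhom (le_timpl tnP); auto with unit01.
apply: le_trans (mphi (x s)).
rewrite (tnCA tnP); auto with unit01.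
apply: (tn_le tnP); auto with unit01.
rewrite -(weightE tnP phiP (x s)); apply: (tn_le tnP); auto with unit01.
Qed.

End Approximation.

(** * The net of a flat weight *)

Section FlatNet.
Variables (R : realType) (tn : R -> R -> R).
Hypotheses (tnP : continuous_tnorm tn) (canc : cancellative tn).
Local Notation "a ** b" := (tn a b) (at level 40, left associativity).
Local Notation "a --o b" := (timpl tn a b) (at level 45, right associativity).
Variables (A : dcat tn) (phi : A -> R) (t : R).
Hypotheses (flat : flat_weight phi t) (t_gt0 : 0 < t).
Implicit Types (x y z : A) (b c d e r : R).

Let phiP : is_weight phi t. Proof. by case: flat. Qed.
Let ht : 0 <= t <= 1. Proof. exact: weight_t01 phiP. Qed.
Let hphi x : 0 <= phi x <= 1. Proof. exact: weight_01 phiP x. Qed.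

(** The last condition keeps the index away from the region where the t-norm
collapses to 0 and cancellation fails. *)
Definition flat_index : Type :=
  {xr : A * R | [/\ 0 <= xr.2 <= 1, xr.2 < rweight phi xr.1 &
                    0 < xr.2 ** dhom xr.1 xr.1]}.

Definition flat_obj (i : flat_index) : A := (sval i).1.

Definition flat_deg (i : flat_index) : R := (sval i).2.

(** The degree is a lower estimate of [rweight phi]; in logarithmic form this
is the relation [dist x y <= r - s] used for weights on metric spaces. *)
Definition flat_le (i j : flat_index) : Prop :=
  flat_deg i <= flat_deg j /\
  flat_deg j --o flat_deg i <= rhom (flat_obj i) (flat_obj j).

Lemma flat_deg_01 i : 0 <= flat_deg i <= 1. Proof. by case: i => i []. Qed.

#[local] Hint Resolve flat_deg_01 : unit01.

Lemma flat_deg_lt i : flat_deg i < rweight phi (flat_obj i).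
Proof. by case: i => i []. Qed.

Lemma flat_deg_type_gt0 i : 0 < flat_deg i ** dhom (flat_obj i) (flat_obj i).
Proof. by case: i => i []. Qed.

(** Flatness for the coweight with values [Num.min t (dhom x x)] provides
objects where [rweight phi x ** Num.min t (dhom x x)] is close to [t]; by
cancellation this forces the first factor close to 1. *)
Lemma flat_index_above c d : 0 <= c <= 1 -> c < 1 -> 0 <= d <= 1 -> d < t ->
  exists i, c < flat_deg i /\ d < flat_deg i ** dhom (flat_obj i) (flat_obj i).
Proof.
move=> hc c1 hd dt; set e := Num.max d (c ** t).
have he : 0 <= e <= 1 by apply: max_01; u01.
have ctt : c ** t < t.
  rewrite -[ltRHS](t1n tnP)//; apply: tn_lt; auto with unit01.
  by rewrite (t1n tnP).
have et : e < t by rewrite gt_max dt.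
have [_ /(_ t ht) + _] := flat; rewrite minxx => wt.
have e0 : 0 <= e by case/andP: he.
have [x ex] := lt_wcomp e0 (etrans (congr1 (fun u => e < u) wt) et).
have [r [hr rx er]] := lt_tn_approxl tnP (rweight_01 phi x)
  (min_01 ht (dhom_01 x x)) he ex.
have era : e < r ** dhom x x.
  apply: lt_le_trans er _; apply: (tn_le tnP); auto with unit01.
  by rewrite ge_min lexx orbT.
have P : [/\ 0 <= r <= 1, r < rweight phi x & 0 < r ** dhom x x].
  by split=> //; apply: le_lt_trans era.
exists (exist _ (x, r) P); rewrite /flat_deg /flat_obj /=; split.
  rewrite ltNge; apply/negP => rc; move: er; apply/negP; rewrite -leNgt.
  apply: (@le_trans _ _ (c ** t)); last by rewrite /e le_max lexx orbT.
  by apply: (tn_le tnP); auto with unit01; rewrite ge_min lexx.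
by apply: le_lt_trans era; rewrite /e le_max lexx.
Qed.

(** The scaling by [d] makes [rhom x] bounded by the types, at the price of a
cancellation of [d] afterwards. *)
Lemma scaled_rhom_coweight x d : 0 <= d <= 1 -> d <= dhom x x ->
  is_coweight (fun y => rhom x y ** d) 1.
Proof.
move=> hd da; split=> [|y|y|y z]; [u01|u01| |].
  rewrite le_min; apply/andP; split; last first.
    by case/andP: (tn_01 tnP (rhom_01 x y) hd).
  apply: le_trans (dhom_le_target x y); rewrite -(dhomE tnP x y).
  by rewrite (tnC tnP (a := dhom x x)); auto with unit01;
     apply: (tn_le tnP); auto with unit01.
rewrite (tnA tnP); auto with unit01.
apply: (tn_le tnP); auto with unit01.
rewrite (tnC tnP); auto with unit01.
exact: rhom_comp.
Qed.

Lemma flat_index_scale i e : 0 <= e <= 1 -> 0 < e ->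
  e < flat_deg i ** dhom (flat_obj i) (flat_obj i) ->
  [/\ flat_deg i ** (flat_deg i --o e) = e,
      flat_deg i --o e <= dhom (flat_obj i) (flat_obj i) &
      e < rweight phi (flat_obj i) ** (flat_deg i --o e)].
Proof.
move=> he e0 ei; have hr := flat_deg_01 i.
have hx := dhom_01 (flat_obj i) (flat_obj i).
have re : flat_deg i ** (flat_deg i --o e) = e.
  rewrite (tn_timpl tnP)//; case/andP: he => -> _ /=.
  by apply: le_trans (ltW ei) _; exact: tn_lel.
split=> //; first by rewrite ltW// (lt_timpl tnP).
rewrite -[ltLHS]re; apply: tn_lt; auto with unit01; last exact: flat_deg_lt.
apply: lt_le_trans e0 _; rewrite -[leLHS]re; apply: (tn_le tnP); auto with unit01.
exact/ltW/flat_deg_lt.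
Qed.

Lemma timplK_le r c : 0 <= r <= 1 -> 0 <= c <= 1 -> 0 < r -> r <= c ->
  (c --o r) --o r <= c.
Proof.
move=> hr hc r0 rc; set w := c --o r; have hw : 0 <= w <= 1 by exact: timpl_01.
have cw : c ** w = r by rewrite (tn_timpl tnP)// rc andbT; case/andP: hr.
have ww : w ** (w --o r) = r.
  by rewrite (tn_timpl tnP)// (timpl_ge tnP)// andbT; case/andP: hr.
apply: (canc (timpl_01 tn w r) hc hw); rewrite (tnC tnP); auto with unit01.
  by rewrite ww.
by rewrite ww cw.
Qed.

(** For an upper bound of two indices, scale the coweights [rhom] of both objects
so that the degrees are taken to a common value [e]. As [phi] preserves their
meet, there is an object [y] where the meet exceeds [e], so that [rhom] from both
objects to [y] is large enough. *)
Lemma flat_le_directed : directed_preorder flat_le.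
Proof.
split.
- have [i _] := flat_index_above (zero_01 R) ltr01 (zero_01 R) t_gt0.
  by constructor; exact: i.
- move=> i; split; rewrite // (rhomxx tnP)//.
  by case/andP: (timpl_01 tn (flat_deg i) (flat_deg i)).
- move=> i j k [ij hij] [jk hjk]; split; first exact: le_trans jk.
  apply: le_trans (rhom_comp tnP (flat_obj i) (flat_obj j) (flat_obj k)).
  apply: le_trans (timpl_chain tnP _ _ _ ij jk) _; auto with unit01.
  by rewrite (tnC tnP); auto with unit01; apply: (tn_le tnP); auto with unit01.
move=> i j.
set ai := flat_deg i ** dhom (flat_obj i) (flat_obj i).
set aj := flat_deg j ** dhom (flat_obj j) (flat_obj j).
have hai : 0 <= ai <= 1 by apply: (tn_01 tnP); u01.
have haj : 0 <= aj <= 1 by apply: (tn_01 tnP); u01.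
have [|e [he e0]] := mid_01 (zero_01 R) (min_01 hai haj).
  by rewrite lt_min !flat_deg_type_gt0.
rewrite lt_min => /andP[ei ej].
have [ri di pi] := flat_index_scale he e0 ei.
have [rj dj pj] := flat_index_scale he e0 ej.
set si := flat_deg i --o e in ri di pi; set sj := flat_deg j --o e in rj dj pj.
have hsi : 0 <= si <= 1 by exact: timpl_01.
have hsj : 0 <= sj <= 1 by exact: timpl_01.
have coi := scaled_rhom_coweight hsi di; have coj := scaled_rhom_coweight hsj dj.
have [y ey] : exists y, e < rweight phi y **
    Num.min (rhom (flat_obj i) y ** si) (rhom (flat_obj j) y ** sj).
  apply: lt_wcomp; first exact: ltW.
  have [_ _ /(_ _ _ _ coi coj) ->] := flat; rewrite lt_min; apply/andP; split.
    apply: lt_le_trans pi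
      (le_trans _ (wcomp_ub tnP phi (flat_obj i) (coweight_01 coi))).
    by rewrite (rhomxx tnP) (t1n tnP).
  apply: lt_le_trans pj
      (le_trans _ (wcomp_ub tnP phi (flat_obj j) (coweight_01 coj))).
  by rewrite (rhomxx tnP) (t1n tnP).
have above k s : 0 <= s <= 1 -> flat_deg k ** s = e ->
    e < rweight phi y ** (rhom (flat_obj k) y ** s) ->
    flat_deg k < rhom (flat_obj k) y ** rweight phi y.
  move=> hs rs; rewrite (tnA tnP); auto with unit01.
  rewrite (tnC tnP (a := rweight phi y)); auto with unit01.
  rewrite -[X in X < _]rs => h; rewrite ltNge; apply/negP => le_r; move: h.
  by apply/negP; rewrite -leNgt; apply: (tn_le tnP); auto with unit01.
have yi : flat_deg i < rhom (flat_obj i) y ** rweight phi y.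
  apply: (above _ _ hsi ri); apply: lt_le_trans ey _.
  by apply: (tn_le tnP); auto with unit01; rewrite ge_min lexx.
have yj : flat_deg j < rhom (flat_obj j) y ** rweight phi y.
  apply: (above _ _ hsj rj); apply: lt_le_trans ey _.
  by apply: (tn_le tnP); auto with unit01; rewrite ge_min lexx orbT.
have e_phi : e < dhom y y ** rweight phi y.
  apply: lt_le_trans ey _; rewrite (tnC tnP); auto with unit01.
  apply: (tn_le tnP); auto with unit01.
  by rewrite ge_min (coweight_le_dhom coi).
(* the least degree that puts [y] above both indices and away from 0 *)
set s := Num.max (Num.max (rhom (flat_obj i) y --o flat_deg i)
  (rhom (flat_obj j) y --o flat_deg j)) (dhom y y --o e).
have hs : 0 <= s <= 1 by apply: max_01; auto with unit01.
have s_ge : [/\ rhom (flat_obj i) y --o flat_deg i <= s,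
    rhom (flat_obj j) y --o flat_deg j <= s & dhom y y --o e <= s].
  by rewrite /s !le_max !lexx !orbT.
have sP : [/\ 0 <= s <= 1, s < rweight phi y & 0 < s ** dhom y y].
  split=> //.
    by rewrite /s !gt_max !(lt_timpl tnP) ?yi ?yj ?e_phi//; auto with unit01.
  apply: (lt_le_trans e0); have [_ _ se] := s_ge.
  have {1}<- : dhom y y ** (dhom y y --o e) = e.
    rewrite (tn_timpl tnP) ?dhom_01// (ltW e0) /=.
    by apply: le_trans (ltW e_phi) _; apply: tn_lel; u01.
  by rewrite (tnC tnP (a := s))//; auto with unit01; apply: (tn_le tnP); u01.
have upper k : rhom (flat_obj k) y --o flat_deg k <= s ->
    flat_deg k < rhom (flat_obj k) y ** rweight phi y ->
    flat_le k (exist _ (y, s) sP).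
  move=> ks ky; rewrite /flat_le {2 3}/flat_deg {2}/flat_obj /=; split.
    by apply: le_trans ks; apply: timpl_ge; auto with unit01.
  apply: (@le_trans _ _ ((rhom (flat_obj k) y --o flat_deg k) --o flat_deg k)).
    rewrite (le_timpl tnP); auto with unit01.
    apply: le_trans (tn_timpl_le tnP hs (flat_deg_01 k)).
    by apply: (tn_le tnP); auto with unit01.
  apply: timplK_le; auto with unit01.
    have h := flat_deg_type_gt0 k; apply: lt_le_trans h _.
    by apply: (tn_lel tnP); auto with unit01.
  by apply: le_trans (ltW ky) _; apply: tn_lel; auto with unit01.
by exists (exist _ (y, s) sP); case: s_ge => hi hj _; split; apply: upper.
Qed.

Lemma flat_le_weight i j : flat_le i j ->
  flat_deg i ** (flat_deg i ** dhom (flat_obj i) (flat_obj i)) <=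
  phi (flat_obj j).
Proof.
move=> [ij hij].
rewrite -(weightE tnP phiP) (tnC tnP (a := dhom _ _)); auto with unit01.
apply: (tn_le tnP); auto with unit01.
  by apply: le_trans ij _; exact/ltW/flat_deg_lt.
apply: le_trans (dhom_le_target (flat_obj i) (flat_obj j)).
rewrite -(dhomE tnP (flat_obj i) (flat_obj j)) (tnC tnP); auto with unit01.
apply: (tn_le tnP); auto with unit01.
by apply: le_trans hij; apply: timpl_ge; auto with unit01.
Qed.

Lemma flat_net_approximates : approximates phi t flat_le flat_obj.
Proof.
split=> [c hc c1|c hc ct|z c hc cz].
- have [i [ci _]] := flat_index_above hc c1 (zero_01 R) t_gt0.
  exists i => j [ij _]; apply: le_trans (ltW ci) (le_trans ij _).
  exact/ltW/flat_deg_lt.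
- have [|r [hr r1 crt]] := lt_tn_approxl tnP (one_01 R) ht hc.
    by rewrite (t1n tnP).
  have [d [hd dt crd]] := lt_tn_approxr tnP hr ht hc crt.
  have [i [ri di]] := flat_index_above hr r1 hd dt.
  exists i => j /flat_le_weight; apply: le_trans.
  apply: le_trans (ltW crd) _; apply: (tn_le tnP); auto with unit01; exact: ltW.
- have cpz : c < rweight phi z ** dhom z z.
    by rewrite (tnC tnP) ?(weightE tnP phiP)//; u01.
  have [r [hr rz cr]] :=
    lt_tn_approxl tnP (rweight_01 phi z) (dhom_01 z z) hc cpz.
  have P : [/\ 0 <= r <= 1, r < rweight phi z & 0 < r ** dhom z z].
    by split=> //; apply: le_lt_trans cr; case/andP: hc.
  exists (exist _ (z, r) P) => j [_]; rewrite {1}/flat_obj {2}/flat_deg /= => zj.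
  rewrite -(dhomE tnP) (tnC tnP); auto with unit01.
  apply: le_trans (ltW cr) _; apply: (tn_le tnP); auto with unit01.
  by apply: le_trans zj; apply: timpl_ge; auto with unit01.
Qed.

Lemma flat_net_forward_cauchy : forward_cauchy flat_le flat_obj.
Proof.
have dir := flat_le_directed; have appr := flat_net_approximates.
rewrite /forward_cauchy; set F := fun p : flat_index * flat_index => _.
have [||||||-> ->] // := @join_meet_limit R flat_index (flat_index * flat_index)
  (fun l => [set p | flat_le l p.1 /\ flat_le p.1 p.2]) F t.
- exact: directed_inhabited dir.
- move=> l l'; have [k [lk l'k]] := directed_ub dir l l'.
  by exists (k, k); have := directed_refl dir k.
- by move=> p; exact: dhom_01.
- move=> c c0 ct; have hc : 0 <= c <= 1 by move: ht; lra.
  have [|d [hd dt cd]] := lt_tn_approxl tnP ht (one_01 R) hc.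
    by rewrite (tn1 tnP).
  have [r [hr r1 cdr]] := lt_tn_approxr tnP hd (one_01 R) hc cd.
  have [i [ri _]] := flat_index_above hr r1 (zero_01 R) t_gt0.
  have [l hl] := ultimately_and dir (approximates_weight appr hd dt)
    (ex_intro (fun l => forall s, flat_le l s -> flat_le i s) i
       (fun s h => h)).
  exists l => -[j k] /= [/hl[dj [ij _]] [jk hjk]]; rewrite /F /=.
  rewrite -(dhomE tnP); apply: le_trans (ltW cdr) _.
  apply: (tn_le tnP); auto with unit01.
    by apply: le_trans dj _; exact: (weight_le_dhom phiP).
  apply: le_trans hjk; apply: le_trans (timpl_ge tnP _ _); auto with unit01.
  exact: le_trans (ltW ri) ij.
- move=> c tc.
  have [l hl] := ultimately_type_le tnP phiP dir appr tc.
  by exists l => -[j k] [/hl + _]; apply: le_trans; exact: dhom_le_source.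
Qed.

Lemma flat_weight_supremum : yoneda_complete A -> exists s, is_supremum phi t s.
Proof.
move=> ycA; have dir := flat_le_directed.
have [s /(yoneda_limit_supremum tnP canc phiP t_gt0 dir flat_net_approximates)] :=
  ycA _ _ _ dir flat_net_forward_cauchy.
by exists s.
Qed.

End FlatNet.

(** * The net of a Cauchy weight *)

Section CauchyNet.
Variables (R : realType) (tn : R -> R -> R).
Hypotheses (tnP : continuous_tnorm tn) (canc : cancellative tn).
Local Notation "a ** b" := (tn a b) (at level 40, left associativity).
Local Notation "a --o b" := (timpl tn a b) (at level 45, right associativity).
Variables (A : dcat tn) (phi psi : A -> R) (t : R).
Hypotheses (phiP : is_weight phi t) (psiP : is_coweight psi t).
Hypothesis unit : t <= wcomp phi psi.
Hypothesis counit : forall x y, (t --o psi y) ** phi x <= dhom x y.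
Hypothesis t_gt0 : 0 < t.

Let ht : 0 <= t <= 1. Proof. exact: weight_t01 phiP. Qed.
Let hphi x : 0 <= phi x <= 1. Proof. exact: weight_01 phiP x. Qed.
Let hpsi x : 0 <= psi x <= 1. Proof. exact: coweight_01 psiP x. Qed.

(** At these objects the unit of the adjunction is attained up to the degree. *)
Definition cauchy_index : Type :=
  {xr : A * R | [/\ 0 <= xr.2 <= 1, xr.2 < 1 &
                    xr.2 <= rweight phi xr.1 ** (t --o psi xr.1)]}.

Definition cauchy_obj (i : cauchy_index) : A := (sval i).1.

Definition cauchy_deg (i : cauchy_index) : R := (sval i).2.

Definition cauchy_le (i j : cauchy_index) : Prop :=
  cauchy_deg i <= cauchy_deg j.

Lemma cauchy_deg_01 i : 0 <= cauchy_deg i <= 1. Proof. by case: i => i []. Qed.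

#[local] Hint Resolve cauchy_deg_01 : unit01.

Lemma cauchy_deg_le i :
  cauchy_deg i <= rweight phi (cauchy_obj i) ** (t --o psi (cauchy_obj i)).
Proof. by case: i => i []. Qed.

Lemma cauchy_deg_le_rweight i : cauchy_deg i <= rweight phi (cauchy_obj i).
Proof. by apply: le_trans (cauchy_deg_le i) _; apply: tn_lel; u01. Qed.

Lemma cauchy_deg_le_psi i : cauchy_deg i <= t --o psi (cauchy_obj i).
Proof. by apply: le_trans (cauchy_deg_le i) _; apply: tn_ler; u01. Qed.

Lemma cauchy_index_of_degree (r : R) : 0 <= r <= 1 -> r < 1 ->
  exists i, cauchy_deg i = r.
Proof.
move=> hr r1.
have rtt : r ** t < t.
  rewrite -[ltRHS](t1n tnP)//; apply: (tn_lt canc); auto with unit01.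
  by rewrite (t1n tnP).
have rt0 : 0 <= r ** t by case/andP: (tn_01 tnP hr ht).
have [x rx] := lt_wcomp rt0 (lt_le_trans rtt unit).
have P : [/\ 0 <= r <= 1, r < 1 & r <= rweight phi x ** (t --o psi x)].
  split=> //; rewrite leNgt; apply/negP => xr; move: rx; apply/negP.
  rewrite -leNgt -(coweightE tnP psiP x) (tnCA tnP); auto with unit01.
  rewrite (tnC tnP (a := t)); auto with unit01.
  by apply: (tn_le tnP); auto with unit01; exact: ltW.
by exists (exist _ (x, r) P).
Qed.

Lemma cauchy_le_directed : directed_preorder cauchy_le.
Proof.
split=> [|i|i j k|i j]; rewrite /cauchy_le //; last 2 first.
- exact: le_trans.
- have [ij|/ltW ji] := leP (cauchy_deg i) (cauchy_deg j); [exists j|exists i];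
  by split.
by have [i _] := cauchy_index_of_degree (zero_01 R) ltr01; constructor; exact: i.
Qed.

Lemma cauchy_net_approximates : approximates phi t cauchy_le cauchy_obj.
Proof.
split=> [c hc c1|c hc ct|z c hc cz].
- have [i ic] := cauchy_index_of_degree hc c1; exists i => j ij.
  by rewrite -ic; apply: le_trans ij _; exact: cauchy_deg_le_rweight.
- have [|r [hr r1 crt]] := lt_tn_approxl tnP (one_01 R) ht hc.
    by rewrite (t1n tnP).
  have [i ir] := cauchy_index_of_degree hr r1; exists i => j ij.
  rewrite -(weightE tnP phiP) (tnC tnP); auto with unit01.
  apply: (@le_trans _ _ (rweight phi (cauchy_obj j) ** psi (cauchy_obj j))).
    rewrite -(coweightE tnP psiP) (tnCA tnP); auto with unit01.
    apply: le_trans (ltW crt) _; rewrite (tnC tnP (a := r))//.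
    apply: (tn_le tnP); auto with unit01.
    by rewrite -ir; apply: le_trans ij _; exact: cauchy_deg_le.
  apply: (tn_le tnP); auto with unit01; exact: (coweight_le_dhom psiP).
- have [|r [hr r1 crt]] := lt_tn_approxl tnP (one_01 R) (hphi z) hc.
    by rewrite (t1n tnP).
  have [i ir] := cauchy_index_of_degree hr r1; exists i => j ij.
  apply: le_trans (counit z (cauchy_obj j)); apply: le_trans (ltW crt) _.
  apply: (tn_le tnP); auto with unit01.
  by rewrite -ir; apply: le_trans ij _; exact: cauchy_deg_le_psi.
Qed.

Lemma cauchy_net_bicauchy : bicauchy cauchy_le cauchy_obj.
Proof.
have dir := cauchy_le_directed; have appr := cauchy_net_approximates.
rewrite /bicauchy; set F := fun p : cauchy_index * cauchy_index => _.
have [||||||-> ->] // := @join_meet_limit R cauchy_index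
  (cauchy_index * cauchy_index)
  (fun l => [set p | cauchy_le l p.1 /\ cauchy_le l p.2]) F t.
- exact: directed_inhabited dir.
- move=> l l'; have [k [lk l'k]] := directed_ub dir l l'.
  by exists (k, k).
- by move=> p; exact: dhom_01.
- move=> c c0 ct; have hc : 0 <= c <= 1 by move: ht; lra.
  have [|d [hd dt cd]] := lt_tn_approxr tnP (one_01 R) ht hc.
    by rewrite (t1n tnP).
  have [r [hr r1 crd]] := lt_tn_approxl tnP (one_01 R) hd hc cd.
  have [i ir] := cauchy_index_of_degree hr r1.
  have [l hl] := ultimately_and dir (approximates_weight appr hd dt)
    (ex_intro (fun l => forall s, cauchy_le l s -> cauchy_le i s) i
       (fun s h => h)).
  exists l => -[j k] /= [/hl[dj _] /hl[_ ik]]; rewrite /F /=.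
  apply: le_trans (counit _ _); apply: le_trans (ltW crd) _.
  apply: (tn_le tnP); auto with unit01.
  by rewrite -ir; apply: le_trans ik _; exact: cauchy_deg_le_psi.
- move=> c tc.
  have [l hl] := ultimately_type_le tnP phiP dir appr tc.
  by exists l => -[j k] [/hl + _]; apply: le_trans; exact: dhom_le_source.
Qed.

Lemma cauchy_weight_supremum : bicomplete A -> exists s, is_supremum phi t s.
Proof.
move=> bcA; have dir := cauchy_le_directed.
have [s /(bilimit_supremum tnP canc phiP t_gt0 dir cauchy_net_approximates)] :=
  bcA _ _ _ dir cauchy_net_bicauchy.
by exists s.
Qed.

End CauchyNet.

Section Completeness.
Variables (R : realType) (tn : R -> R -> R).
Hypotheses (tnP : continuous_tnorm tn).
Variables (A : dcat tn).

Lemma is_supremum_isolated (phi : A -> R) (s : A) :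
  is_isolated s -> is_supremum phi 0 s.
Proof.
move=> ss; split=> // y; have h01 x : 0 <= timpl tn (phi x) (dhom x y) <= 1.
  exact: timpl_01.
rewrite (tn0 tnP); last exact: meet01_01.
case/andP: (dhom_01 y y) => y0 _; rewrite min_r//.
apply/eqP; rewrite eq_le; case/andP: (dhom_01 s y) => -> _; rewrite andbT.
by rewrite -[leRHS]ss dhom_le_source.
Qed.

Hypothesis canc : cancellative tn.

Lemma cancellative_flat_complete :
  yoneda_complete A -> (exists x : A, is_isolated x) -> flat_complete A.
Proof.
move=> ycA [s ss] phi t flat; have [t01 _ _ _] : is_weight phi t by case: flat.
have [t0|t0] := ltP 0 t; first exact: flat_weight_supremum.
have -> : t = 0 by apply/eqP; rewrite eq_le t0; case/andP: t01.
by exists s; exact: is_supremum_isolated.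
Qed.

Lemma cancellative_cauchy_complete :
  bicomplete A -> (exists x : A, is_isolated x) -> cauchy_complete A.
Proof.
move=> bcA [s ss] phi t [phiP [psi [psiP unit counit]]].
have [t0|t0] := ltP 0 t; first exact: (cauchy_weight_supremum tnP canc phiP psiP).
have -> : t = 0.
  by apply/eqP; rewrite eq_le t0; case/andP: (weight_t01 phiP).
by exists s; exact: is_supremum_isolated.
Qed.

End Completeness.

(** * Idempotents obstruct Cauchy completeness *)

Section TwoPoints.
Variables (R : realType) (tn : R -> R -> R).
Hypothesis tnP : continuous_tnorm tn.
Local Notation "a ** b" := (tn a b) (at level 40, left associativity).
Local Notation "a --o b" := (timpl tn a b) (at level 45, right associativity).

Definition bool_hom (x y : bool) : R := (x && y)%:R.

Lemma bool_hom_01 x y : 0 <= bool_hom x y <= 1.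
Proof. by case: x; case: y; rewrite /bool_hom /= ?lexx ?ler01. Qed.

Lemma bool_hom_le x y :
  bool_hom x y <= Num.min (bool_hom x x) (bool_hom y y).
Proof. by case: x; case: y; rewrite /bool_hom /= le_min ?lexx ?ler01. Qed.

Lemma bool_hom_comp x y z :
  (bool_hom y y --o bool_hom y z) ** bool_hom x y <= bool_hom x z.
Proof.
have le0 c : 0 <= c <= 1 -> c ** 0 <= bool_hom x z.
  by move=> hc; rewrite (tn0 tnP)//; case/andP: (bool_hom_01 x z).
case: x le0 => le0; last by rewrite {3}/bool_hom; apply: le0; exact: timpl_01.
case: y; last by rewrite {3}/bool_hom; apply: le0; exact: timpl_01.
rewrite /bool_hom /= (tn1 tnP); last exact: timpl_01.
have := tn_timpl_le tnP (one_01 R) (bool_hom_01 true z).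
by rewrite (t1n tnP)//; exact: timpl_01.
Qed.

Definition bool_dcat : dcat tn :=
  DCat bool_hom_01 bool_hom_le bool_hom_comp.

Lemma bool_isolated : exists x : bool_dcat, is_isolated x.
Proof. by exists false. Qed.

Section Net.
Variables (I : Type) (le : I -> I -> Prop) (x : I -> bool_dcat).
Hypothesis dir : directed_preorder le.

(** Values of [bool_hom] are 0 or 1. If a net is both often [true] and often
[false], the diagonal pairs make the join of meets 0 and the meet of joins 1. Here
[S] stands for the family of index pairs of either Cauchy condition. *)
Lemma ultimately_constant (S : I -> set (I * I)) :
  (forall l s, le l s -> S l (s, s)) ->
  let F p := dhom (x p.1) (x p.2) in
  join01 [set: I] (fun l => meet01 (S l) F) =
    meet01 [set: I] (fun l => join01 (S l) F) ->
  exists b, ultimately le (fun s => x s = b).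
Proof.
move=> diag F cauchy.
have hF p : 0 <= F p <= 1 by exact: dhom_01.
have [[l hl]|often_false] := pselect (ultimately le (fun s => x s = true)).
  by exists true, l.
exists false; apply: contrapT => often_true.
have join0 : join01 [set: I] (fun l => meet01 (S l) F) <= 0.
  apply: join01_lub => // l _; apply: contrapT => /negP; rewrite -ltNge => m0.
  apply: often_false; exists l => s ls.
  case xs: (x s) => //; exfalso; move: m0; apply/negP; rewrite -leNgt.
  apply: le_trans (meet01_lb hF (diag _ _ ls)) _.
  by rewrite /F /= xs.
have meet1 : 1 <= meet01 [set: I] (fun l => join01 (S l) F).
  apply: meet01_glb => // l _; apply: contrapT => /negP; rewrite -ltNge => j1.
  apply: often_true; exists l => s ls.
  case xs: (x s) => //; exfalso; move: j1; apply/negP; rewrite -leNgt.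
  apply: le_trans (join01_ub hF (diag _ _ ls)).
  by rewrite /F /= xs.
by rewrite -cauchy in meet1; have := le_trans meet1 join0; rewrite ler10.
Qed.

Lemma liminf01_constant (F : I -> R) c : (forall s, 0 <= F s <= 1) ->
  0 <= c <= 1 -> ultimately le (fun s => F s = c) -> liminf01 le F = c.
Proof.
move=> hF hc [l hl]; apply: liminf01_limit => // d.
  by move=> _ dc; exists l => s /hl ->; exact: ltW.
by move=> cd; exists l => s /hl ->; exact: ltW.
Qed.

End Net.

Lemma bool_yoneda_complete : yoneda_complete bool_dcat.
Proof.
move=> I le x dir cauchy.
have diag l s : le l s -> le l s /\ le s s.
  by move=> ls; split=> //; exact: (directed_refl dir).
have [b [l hl]] := ultimately_constant diag cauchy; exists b.
split=> [|y]; apply/esym/liminf01_constant => //;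
  try (by move=> s; exact: dhom_01); try exact: dhom_01.
  by exists l => s /hl ->.
by exists l => s /hl ->.
Qed.

Lemma bool_bicomplete : bicomplete bool_dcat.
Proof.
move=> I le x dir cauchy.
have diag l s : le l s -> le l s /\ le l s by [].
have [b [l hl]] := ultimately_constant diag cauchy; exists b.
split; apply/esym/liminf01_constant => //;
  try (by move=> s; exact: dhom_01); try exact: dhom_01;
  by exists l => s /hl ->.
Qed.

(** An idempotent [e], placed at the object of type 1, is a Cauchy weight of
type [e] with itself as left adjoint; a supremum of it is an object of
type [e]. *)
Lemma bool_cauchy_complete_idempotent e : 0 <= e <= 1 -> e ** e = e ->
  cauchy_complete bool_dcat -> e = 0 \/ e = 1.
Proof.
move=> he ee ccA.
pose phi (x : bool_dcat) : R := if x then e else 0.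
have phi01 x : 0 <= phi x <= 1 by case: x => //; u01.
have phi_le (x : bool_dcat) : phi x <= Num.min (dhom x x) e.
  by case: x; rewrite /= /bool_hom /= le_min lexx ?andbT; case/andP: he.
have t1 (c : R) : 0 <= c <= 1 -> 1 --o c = c.
  move=> hc; rewrite -[LHS](t1n tnP); last exact: timpl_01.
  by rewrite (tn_timpl tnP)//; u01.
have i01 (a b : R) : 0 <= a --o b <= 1 by exact: timpl_01.
have e0 : 0 <= e by case/andP: he.
have [|s [ss _]] := ccA phi e; last by case: s ss => /= <-; [right|left].
split.
  split=> // -[] [] /=; rewrite /bool_hom /= ?t1 ?(tn1 tnP) ?(tn0 tnP)//; u01.
exists phi; split=> [|| [] [] /=].
- split=> // -[] [] /=;
    rewrite /bool_hom /= ?t1 ?(t0n tnP) ?(t1n tnP) ?(tn0 tnP)//; u01.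
- rewrite -[leLHS]ee; apply: le_trans (wcomp_ub tnP phi true phi01).
  by rewrite /rweight /= /bool_hom /= t1.
- by rewrite /bool_hom /=; case/andP: (tn_01 tnP (i01 e e) he).
- rewrite /bool_hom /= (tnC tnP)//; exact: (tn_timpl_le tnP he (zero_01 R)).
- by rewrite /bool_hom /= (tn0 tnP).
- by rewrite /bool_hom /= (tn0 tnP).
Qed.

End TwoPoints.

(** * Dyadic powers *)

(** The greatest square root, which at 0 need not be 0. This allows 0 as the base
point of dyadic powers for a t-norm with zero divisors. *)
Definition troot (R : realType) (tn : R -> R -> R) (x : R) : R :=
  sup [set y : R | 0 <= y <= 1 /\ tn y y <= x].

(** Then [tpow tn (troot_iter tn c n) k] plays the role of [c] to the power
[k / 2 ^ n]. *)
Definition troot_iter (R : realType) (tn : R -> R -> R) (c : R) (n : nat) : R :=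
  iter n (troot tn) c.

Section Dyadic.
Variables (R : realType) (tn : R -> R -> R).
Hypotheses (tnP : continuous_tnorm tn) (idem : idempotent_free tn).
Local Notation "a ** b" := (tn a b) (at level 40, left associativity).
Implicit Types x y z c : R.

Lemma troot_01 x : 0 <= x <= 1 -> 0 <= troot tn x <= 1.
Proof.
move=> hx; rewrite /troot; set S := [set y | _].
have S0 : S 0 by split; [u01|rewrite (tn0 tnP) ?zero_01//; case/andP: hx].
apply/andP; split; last by apply: ge_sup => [|y [/andP[]]//]; exists 0.
by apply: ub_le_sup => //; exists 1 => y [/andP[]].
Qed.

Lemma le_troot x y : 0 <= y <= 1 -> y ** y <= x -> y <= troot tn x.
Proof. by move=> hy yx; apply: ub_le_sup => //; exists 1 => z [/andP[]]. Qed.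

Lemma troot_sqr x : 0 <= x <= 1 -> troot tn x ** troot tn x = x.
Proof.
move=> hx; have hr := troot_01 hx; have hrr := tn_01 tnP hr hr.
apply/eqP; rewrite eq_le; apply/andP; split.
  rewrite leNgt; apply/negP => xr.
  have [m [hm xm mr]] := mid_01 hx hrr xr.
  have [y hy ym] := tn_square_ivt tnP hm.
  have yr : y < troot tn x.
    rewrite ltNge; apply/negP => ry.
    by have := tn_le tnP hr hy hr hy ry ry; rewrite ym leNgt mr.
  have [|z [hz zx] yz] := sup_gt _ yr.
    by exists 0; split; [u01|rewrite (tn0 tnP) ?zero_01//; case/andP: hx].
  have := tn_le tnP hy hz hy hz (ltW yz) (ltW yz).
  by rewrite ym => /le_trans/(_ zx); rewrite leNgt xm.
have [y hy yx] := tn_square_ivt tnP hx.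
rewrite -[leLHS]yx; have yr : y <= troot tn x by rewrite le_troot// yx.
exact: (tn_le tnP).
Qed.

Section Root.
Variable c : R.
Hypotheses (hc : 0 <= c <= 1) (c1 : c < 1) (root_gt0 : 0 < troot tn c).

Local Notation r n := (troot_iter tn c n).
Local Notation dy n k := (tpow tn (troot_iter tn c n) k).

Lemma troot_iter_01 n : 0 <= r n <= 1.
Proof. by elim: n => //= n IH; exact: troot_01. Qed.

#[local] Hint Resolve troot_iter_01 : unit01.

Lemma troot_iterS n : r n.+1 ** r n.+1 = r n.
Proof. exact/troot_sqr/troot_iter_01. Qed.

Lemma dyadic_refine n m k : dy (n + m) (2 ^ m * k) = dy n k.
Proof.
elim: m n k => [|m IH] n k; first by rewrite addn0 mul1n.
rewrite addnS -addSn expnSr -mulnA IH (tpowM tnP); auto with unit01.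
by rewrite (tpowD tnP 1 1) ?(tpow1 tnP) ?troot_iterS//; u01.
Qed.

Lemma troot_iter_lt1 n : r n < 1.
Proof.
elim: n => //= n IH; rewrite lt_neqAle; have := troot_iter_01 n.+1.
case/andP => _ /= ->; rewrite andbT; apply: contraTneq IH => r1.
by rewrite -(troot_sqr (troot_iter_01 n)) r1 (tn1 tnP) ?one_01// ltxx.
Qed.

Lemma troot_iter_le n : r n <= r n.+1.
Proof. by rewrite -{1}troot_iterS; apply: tn_lel; u01. Qed.

(** The supremum of the roots is idempotent and positive, hence 1. *)
Lemma troot_iter_sup z : 0 <= z <= 1 -> z < 1 -> exists n, z < r n.
Proof.
move=> hz z1; apply: contrapT => nh.
have rz n : r n <= z by rewrite leNgt; apply/negP => zr; apply: nh; exists n.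
set s := join01 [set: nat] (fun n => r n).
have hr n : 0 <= r n <= 1 by u01.
have hs : 0 <= s <= 1 by exact: join01_01.
have rs n : r n <= s by exact: (join01_ub (F := fun n => r n)).
have sz : s <= z by apply: join01_lub => //; case/andP: hz.
have ss : s ** s = s.
  apply/eqP; rewrite eq_le tn_lel//=.
  apply: join01_lub => [|n _]; first by case/andP: (tn_01 tnP hs hs).
  by rewrite -troot_iterS; apply: (tn_le tnP); u01.
case: (idem hs ss) => s01; last by lra.
by have := rs 1%N; rewrite s01 leNgt root_gt0.
Qed.

(** Take a root so close to 1 that multiplication by it does not lead from [y] to
below [x]; its first power below [y] is then above [x]. *)
Lemma dyadic_dense x y : 0 <= x <= 1 -> 0 <= y <= 1 -> x < y ->
  exists n k, x < dy n k /\ dy n k < y.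
Proof.
move=> hx hy xy; have [z [hz xz zy]] := mid_01 hx hy xy.
have [|a [ha a1 xaz]] := lt_tn_approxl tnP (one_01 R) hz hx.
  by rewrite (t1n tnP).
have [n an] := troot_iter_sup ha a1; exists n.
have [k dk] : exists k, dy n k < y.
  apply: contrapT => nh; suff y0 : y = 0 by lra.
  apply: (le_tpow_eq0 tnP idem (troot_iter_01 n) (troot_iter_lt1 n) hy) => k.
  by rewrite leNgt; apply/negP => h; apply: nh; exists k.
have ex : exists k, dy n k < y by exists k.
case: (ex_minnP ex) => -[|m] dm min_m.
  by move: dm; rewrite /tpow /=; lra.
exists m.+1; split=> //; apply: lt_le_trans xaz _.
have -> : dy n m.+1 = r n ** dy n m by [].
apply: (tn_le tnP); auto with unit01.
apply: (le_trans (ltW zy)); rewrite leNgt; apply/negP => /min_m.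
by rewrite ltnn.
Qed.

(** Powers of one root decrease strictly until they reach 0. *)
Lemma le_dyadic n i j : (dy n i <= dy n j) = ((j <= i)%N || (dy n i == 0)).
Proof.
have hd k : 0 <= dy n k <= 1 by u01.
have [ji|ij] := leqP j i; first by rewrite (tpow_anti tnP)//; u01.
apply/idP/eqP => /= [le_ij|->]; last by case/andP: (hd j).
apply: (tn_absorb_eq0 tnP idem (troot_iter_01 n) (troot_iter_lt1 n)) => //.
apply: (le_trans le_ij).
rewrite -(subnKC ij) addSn -addnS (tpowD tnP); auto with unit01.
apply: (tn_le tnP); auto with unit01 => /=.
by apply: tn_lel; u01.
Qed.

End Root.

Lemma strict_dyadic_neq0 c n k : 0 <= c <= 1 -> 0 < c ->
  (forall x y, 0 <= x <= 1 -> 0 <= y <= 1 -> 0 < x -> 0 < y -> 0 < x ** y) ->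
  tpow tn (troot_iter tn c n) k != 0.
Proof.
move=> hc c0 strict; have hr m := troot_iter_01 hc m.
have r0 m : 0 < troot_iter tn c m.
  elim: m => //= m IH; apply: (lt_le_trans IH).
  exact: (troot_iter_le hc m).
rewrite gt_eqF//; elim: k => [|k IH] /=; first exact: ltr01.
by apply: strict => //; u01.
Qed.

(** If a power with exponent [k < 2 ^ n] vanished, the same power of the next
root would be a square root of 0. But it exceeds the greatest one, which is the
power of that root with exponent [2 ^ n]. *)
Lemma nilpotent_dyadic_eq0 n k : 0 < troot tn 0 ->
  (tpow tn (troot_iter tn 0 n) k == 0) = (2 ^ n <= k)%N.
Proof.
move=> root0; have hr := troot_iter_01 (zero_01 R).
have r0 : tpow tn (troot_iter tn 0 n) (2 ^ n) = 0.
  have := dyadic_refine (zero_01 R) 0 n 1; rewrite add0n muln1 => ->.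
  by rewrite (tpow1 tnP)//; u01.
apply/eqP/idP => [dk|nk]; last first.
  apply/eqP; rewrite eq_le -[X in _ <= X]r0 (tpow_anti tnP (hr n) nk).
  by case/andP: (tpow_01 tnP k (hr n)).
rewrite leqNgt; apply/negP => kn.
set w := tpow tn (troot_iter tn 0 n.+1) k.
have hw : 0 <= w <= 1 by apply: tpow_01.
have ww : w ** w = 0.
  rewrite -(tpowD tnP)// addnn -mul2n.
  by have := dyadic_refine (zero_01 R) n 1 k; rewrite addn1 expn1 => ->.
have w_le : w <= troot tn 0 by apply: le_troot; rewrite // ww.
have root_le : troot tn 0 <= w ** troot_iter tn 0 n.+1.
  have := dyadic_refine (zero_01 R) 1 n 1.
  rewrite add1n muln1 (tpow1 tnP); last exact: hr.
  rewrite -[troot tn 0]/(troot_iter tn 0 1) => <-.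
  apply: (@le_trans _ _ (tpow tn (troot_iter tn 0 n.+1) k.+1)).
    exact: (tpow_anti tnP).
  by rewrite -[tpow _ _ _]/(troot_iter tn 0 n.+1 ** w) (tnC tnP).
have w0 : w = 0.
  apply: (tn_absorb_eq0 tnP idem (hr n.+1) _ hw (le_trans w_le root_le)).
  exact: (troot_iter_lt1 (zero_01 R) ltr01).
by move: root_le; rewrite w0 (t0n tnP)// leNgt root0.
Qed.

End Dyadic.

(** * Isomorphisms from dyadic powers *)

Section Transfer.
Variable R : realType.
Implicit Types (tn : R -> R -> R) (c x y : R).

(** The condition on the root excludes the base 0 for a t-norm without zero
divisors, where all roots would be 0. *)
Record dyadic_base tn c : Prop := DyadicBase {
  dyadic_tnorm : continuous_tnorm tn;
  dyadic_idem : idempotent_free tn;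
  dyadic_01 : 0 <= c <= 1;
  dyadic_lt1 : c < 1;
  dyadic_root : 0 < troot tn c
}.

Definition dyadic tn c (nk : nat * nat) : R :=
  tpow tn (troot_iter tn c nk.1) nk.2.

Definition same_zeros tn c tn' c' : Prop :=
  forall nk, (dyadic tn c nk == 0) = (dyadic tn' c' nk == 0).

(** The extension by suprema of the correspondence between dyadic powers. *)
Definition transfer tn c tn' c' x : R :=
  join01 [set nk | dyadic tn c nk <= x] (dyadic tn' c').

Lemma dyadic_power_01 tn c nk : dyadic_base tn c -> 0 <= dyadic tn c nk <= 1.
Proof.
move=> b; apply: tpow_01; first exact: dyadic_tnorm b.
by apply: troot_iter_01; [exact: dyadic_tnorm b|exact: dyadic_01 b].
Qed.

Lemma dyadic_common tn c n m k : dyadic_base tn c ->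
  dyadic tn c (n + m, 2 ^ m * k)%N = dyadic tn c (n, k).
Proof.
by move=> b; apply: dyadic_refine; [exact: dyadic_tnorm b|exact: dyadic_01 b].
Qed.

Lemma dyadicM tn c n k m l : dyadic_base tn c ->
  tn (dyadic tn c (n, k)) (dyadic tn c (m, l)) =
  dyadic tn c (n + m, 2 ^ m * k + 2 ^ n * l)%N.
Proof.
move=> b; rewrite -(dyadic_common n m k b) -(dyadic_common m n l b) (addnC m).
rewrite /dyadic /= [in RHS](tpowD (dyadic_tnorm b))//.
by apply: troot_iter_01; [exact: dyadic_tnorm b|exact: dyadic_01 b].
Qed.

Section Pair.
Variables (tn tn' : R -> R -> R) (c c' : R).
Hypotheses (b : dyadic_base tn c) (b' : dyadic_base tn' c').
Hypothesis zeros : same_zeros tn c tn' c'.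

Let tnP := dyadic_tnorm b.
Let tnP' := dyadic_tnorm b'.
Let d01 nk := dyadic_power_01 nk b.
Let d01' nk := dyadic_power_01 nk b'.

(** Two dyadic powers are powers of a common root, where the order is that of the
exponents until 0 is reached. *)
Lemma same_zeros_le nk ml :
  (dyadic tn c nk <= dyadic tn c ml) = (dyadic tn' c' nk <= dyadic tn' c' ml).
Proof.
case: nk ml => [n k] [m l].
rewrite -(dyadic_common n m k b) -(dyadic_common m n l b).
rewrite -(dyadic_common n m k b') -(dyadic_common m n l b') (addnC m).
rewrite /dyadic /= (le_dyadic tnP (dyadic_idem b) (dyadic_01 b) (dyadic_lt1 b)).
rewrite (le_dyadic tnP' (dyadic_idem b') (dyadic_01 b') (dyadic_lt1 b')).
by have := zeros (n + m, 2 ^ m * k)%N; rewrite /dyadic /= => ->.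
Qed.

Lemma transfer_01 x : 0 <= transfer tn c tn' c' x <= 1.
Proof. exact: join01_01. Qed.

Lemma transfer_le x y : x <= y ->
  transfer tn c tn' c' x <= transfer tn c tn' c' y.
Proof.
move=> xy; apply: join01_lub => [|nk /= nkx].
  by case/andP: (transfer_01 y).
by apply: (join01_ub d01' (i := nk)); exact: le_trans xy.
Qed.

(** The product of two dyadic powers is a dyadic power, with the same indices
for both t-norms. *)
Lemma transfer_superM x y : 0 <= x <= 1 -> 0 <= y <= 1 ->
  tn' (transfer tn c tn' c' x) (transfer tn c tn' c' y) <=
  transfer tn c tn' c' (tn x y).
Proof.
move=> hx hy; have hT := transfer_01.
apply: (tn_join01_le tnP') => // -[m l] /= mly.
rewrite (tnC tnP')//; apply: (tn_join01_le tnP') => // -[n k] /= nkx.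
rewrite (dyadicM _ _ _ _ b'); apply: join01_ub => //=.
rewrite -(dyadicM _ _ _ _ b) (tnC tnP)//.
exact: (tn_le tnP).
Qed.

End Pair.

Lemma same_zeros_sym tn c tn' c' :
  same_zeros tn c tn' c' -> same_zeros tn' c' tn c.
Proof. by move=> h nk; rewrite h. Qed.

(** The correspondence preserves the order of the dyadic powers in both
directions, and these are dense. *)
Lemma transferK tn c tn' c' x : dyadic_base tn c -> dyadic_base tn' c' ->
  same_zeros tn c tn' c' -> 0 <= x <= 1 ->
  transfer tn' c' tn c (transfer tn c tn' c' x) = x.
Proof.
move=> b b' zeros hx; set y := transfer tn c tn' c' x.
have d01 nk := dyadic_power_01 nk b; have d01' nk := dyadic_power_01 nk b'.
have dense u v : 0 <= u <= 1 -> 0 <= v <= 1 -> u < v ->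
    exists nk, u < dyadic tn c nk /\ dyadic tn c nk < v.
  move=> hu hv uv; have [n [k h]] :=
    dyadic_dense (dyadic_tnorm b) (dyadic_idem b) (dyadic_01 b) (dyadic_lt1 b)
      (dyadic_root b) hu hv uv.
  by exists (n, k).
have leE := same_zeros_le b b' zeros.
have hz : 0 <= transfer tn' c' tn c y <= 1 by exact: join01_01.
apply/eqP; rewrite eq_le; apply/andP; split.
  apply: join01_lub => [|nk /= nky]; first by case/andP: hx.
  rewrite leNgt; apply/negP => x_nk.
  have [ml [x_ml ml_nk]] := dense _ _ hx (d01 nk) x_nk.
  move: ml_nk; apply/negP; rewrite -leNgt leE; apply: (le_trans nky).
  apply: join01_lub => [|ij /= ijx]; first by case/andP: (d01' ml).
  by rewrite -leE; apply: le_trans ijx (ltW x_ml).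
rewrite leNgt; apply/negP => zx.
have [nk [z_nk nk_x]] := dense _ _ hz hx zx.
move: z_nk; apply/negP; rewrite -leNgt.
apply: (join01_ub d01) => /=; apply: (join01_ub d01') => /=.
exact: ltW.
Qed.

(** The inequality of [transfer_superM] for the transfer and for its inverse
gives equality. *)
Lemma same_zeros_isomorphic tn c tn' c' :
  dyadic_base tn c -> dyadic_base tn' c' -> same_zeros tn c tn' c' ->
  tnorm_isomorphic tn tn'.
Proof.
move=> b b' zeros; have zeros' := same_zeros_sym zeros.
set F := transfer tn c tn' c'; set G := transfer tn' c' tn c.
have F01 x : 0 <= F x <= 1 by exact: transfer_01.
have G01 x : 0 <= G x <= 1 by exact: transfer_01.
have FK x : 0 <= x <= 1 -> G (F x) = x by exact: transferK.
have GK x : 0 <= x <= 1 -> F (G x) = x by exact: transferK.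
have F_le x y : x <= y -> F x <= F y by exact: transfer_le.
have G_le x y : x <= y -> G x <= G y by exact: transfer_le.
have tnP := dyadic_tnorm b; have tnP' := dyadic_tnorm b'.
exists F; split.
- split.
  + by move=> x _ /=; rewrite in_itv/=; exact: F01.
  + move=> x y; rewrite !inE /= !in_itv/= => hx hy e.
    by rewrite -(FK x hx) e FK.
  + move=> y /=; rewrite in_itv/= => hy.
    by exists (G y); rewrite /= ?in_itv/=; auto.
- move=> x y hx hy; apply/idP/idP => [/G_le|]; last exact: F_le.
  by rewrite !FK.
move=> x y hx hy; apply/eqP; rewrite eq_le; apply/andP; split; last first.
  exact: transfer_superM.
have hFxy := tn_01 tnP' (F01 x) (F01 y).
rewrite -[leRHS]GK//; apply: F_le.
rewrite -{1}(FK x hx) -{1}(FK y hy); exact: (transfer_superM b' b).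
Qed.

End Transfer.

(** * Classification by the Lukasiewicz and product t-norms *)

Section Examples.
Variable R : realType.

Lemma product_continuous_tnorm : continuous_tnorm (@product_tnorm R).
Proof.
rewrite /product_tnorm; split.
- by move=> a b ha hb; nra.
- by move=> a b c _ _ _; rewrite mulrA.
- by move=> a b _ _; rewrite mulrC.
- by move=> a a' b b' /andP[a0 _] _ /andP[b0 _] _ aa' bb'; exact: ler_pM.
- by move=> a _; rewrite mulr1.
apply: continuous_subspaceT => p.
by apply: cvgM; [exact: cvg_fst|exact: cvg_snd].
Qed.

Lemma lukasiewicz_continuous_tnorm : continuous_tnorm (@lukasiewicz R).
Proof.
rewrite /lukasiewicz; split.
- by move=> a b ha hb; case: (leP (a + b - 1) 0) => h; lra.
- move=> a b c ha hb hc.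
  case: (leP (b + c - 1) 0) => h1; case: (leP (a + b - 1) 0) => h2.
  + by rewrite !max_r; lra.
  + by case: (leP (a + b - 1 + c - 1) 0) => h3; rewrite max_r; lra.
  + by case: (leP (a + (b + c - 1) - 1) 0) => h3; rewrite max_r; lra.
  + by rewrite (_ : a + (b + c - 1) - 1 = a + b - 1 + c - 1); last lra.
- by move=> a b _ _; rewrite (addrC a).
- move=> a a' b b' _ _ _ _ aa' bb'.
  case: (leP (a + b - 1) 0) => h1; case: (leP (a' + b' - 1) 0) => h2; lra.
- by move=> a ha; case: (leP (a + 1 - 1) 0) => h; lra.
apply: continuous_subspaceT => p.
apply: (@continuous_max _ _ (fun p : R * R => p.1 + p.2 - 1) (fun=> 0)).
  by apply: cvgB; [apply: cvgD; [exact: cvg_fst|exact: cvg_snd]|exact: cvg_cst].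
exact: cvg_cst.
Qed.

Lemma product_idempotent_free : idempotent_free (@product_tnorm R).
Proof.
move=> e _; rewrite /product_tnorm => ee.
have /eqP : e * (e - 1) = 0 by rewrite mulrBr ee mulr1 subrr.
by rewrite mulf_eq0 subr_eq0 => /orP[]/eqP; [left|right].
Qed.

Lemma lukasiewicz_idempotent_free : idempotent_free (@lukasiewicz R).
Proof.
move=> e he; rewrite /lukasiewicz.
by case: (leP (e + e - 1) 0) => h ee; [left|right]; lra.
Qed.

End Examples.

(** Without zero divisors every dyadic power of 1/2 is positive. With zero
divisors the base is 0, and the powers of its root of order [2 ^ n] vanish exactly
from exponent [2 ^ n] on. Either way the pattern of zeros does not depend on the
t-norm. *)
Lemma idempotent_free_isomorphic (R : realType) (tn : R -> R -> R) :
  continuous_tnorm tn -> idempotent_free tn ->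
  tnorm_isomorphic tn (@lukasiewicz R) \/
  tnorm_isomorphic tn (@product_tnorm R).
Proof.
move=> tnP idem.
have half_01 : 0 <= (2^-1 : R) <= 1 by lra.
have half_gt0 : 0 < (2^-1 : R) by lra.
have half_lt1 : (2^-1 : R) < 1 by lra.
have root_half (s : R -> R -> R) : continuous_tnorm s -> 0 < troot s 2^-1.
  move=> sP; have half_le := troot_iter_le sP half_01 0.
  exact: lt_le_trans half_gt0 half_le.
have [strict|nstrict] := pselect (forall x y, 0 <= x <= 1 -> 0 <= y <= 1 ->
  0 < x -> 0 < y -> 0 < tn x y); [right|left].
  have prodP := product_continuous_tnorm R.
  apply: (@same_zeros_isomorphic _ tn 2^-1 _ 2^-1).
  - by split; auto.
  - by split; auto; exact: product_idempotent_free.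
  move=> [n k]; rewrite /dyadic !(negbTE (strict_dyadic_neq0 _ _ _ _ _ _))//.
  by move=> x y _ _; exact: mulr_gt0.
have lukP := lukasiewicz_continuous_tnorm R.
have root0 : 0 < troot tn 0.
  rewrite lt_neqAle; have [hr0 _] := andP (troot_01 tnP (zero_01 R)).
  rewrite hr0 andbT; apply/negP => /eqP r0; apply: nstrict => x y hx hy x0 y0.
  rewrite lt_neqAle; have [hxy0 _] := andP (tn_01 tnP hx hy).
  rewrite hxy0 andbT; apply/negP => /eqP xy0.
  set m := Num.min x y; have hm : 0 <= m <= 1 by exact: min_01.
  have : m <= troot tn 0.
    apply: le_troot => //; rewrite xy0.
    by apply: (tn_le tnP) => //; rewrite ge_min lexx ?orbT.
  by rewrite -r0 leNgt lt_min x0 y0.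
have luk_root0 : 0 < troot (@lukasiewicz R) 0.
  apply: (lt_le_trans half_gt0); apply: le_troot => //.
  by rewrite /lukasiewicz; case: (leP (2^-1 + 2^-1 - 1 : R) 0) => h; lra.
have luk_idem := @lukasiewicz_idempotent_free R.
apply: (@same_zeros_isomorphic _ tn 0 _ 0).
- by split; rewrite ?lexx ?ler01 ?ltr01.
- by split; rewrite ?lexx ?ler01 ?ltr01.
by move=> [n k]; rewrite /dyadic !nilpotent_dyadic_eq0.
Qed.

Theorem theorem7p8 (R : realType) (tn : R -> R -> R)
    (tnP : continuous_tnorm tn) :
  [<-> tnorm_isomorphic tn (@lukasiewicz R)
         \/ tnorm_isomorphic tn (@product_tnorm R);
       forall A : dcat tn,
         yoneda_complete A -> (exists x : A, is_isolated x) -> flat_complete A;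
       forall A : dcat tn,
         yoneda_complete A -> (exists x : A, is_isolated x) -> cauchy_complete A;
       forall A : dcat tn,
         bicomplete A -> (exists x : A, is_isolated x) -> cauchy_complete A].
Proof.
(* the category on [bool] satisfies both completeness hypotheses, so each of the
   last two conditions excludes idempotents *)
have idem_of : cauchy_complete (bool_dcat tnP) -> idempotent_free tn.
  by move=> cc e he ee; exact: bool_cauchy_complete_idempotent cc.
split=> [iso A yA isoA|].
  apply: cancellative_flat_complete => //.
  case: iso => iso; apply: (cancellative_isomorphic tnP iso).
    exact: lukasiewicz_cancellative.
  exact: product_cancellative.
split=> [flatA A yA isoA phi t phiP|].
  exact: (flatA A yA isoA phi t (cauchy_weight_flat tnP phiP)).
split=> [ccA A bA isoA|ccA].
  apply: cancellative_cauchy_complete => //.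
  apply: idempotent_free_cancellative => //; apply: idem_of.
  by apply: ccA; [exact: bool_yoneda_complete|exact: bool_isolated].
apply: idempotent_free_isomorphic => //; apply: idem_of.
by apply: ccA; [exact: bool_bicomplete|exact: bool_isolated].
Qed.
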